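(* Let $n\ge 3$, let $\varepsilon>0$, and assume $f\in C^3(\mathbb{R}^n)$, $g\in C^2(\mathbb{R}^n)$ and $F\in C^2(\mathbb{R}^n\times[0,\infty))$. Let $u$ be a solution of the integral equation \[ u(x,t)=\varepsilon V(x,t)+N(F)(x,t),\qquad (x,t)\in\mathbb{R}^n\times[0,\infty), \] where \[ V(x,t)=\frac{1}{\omega_n}\int_{|\omega|=1}\left(\frac{t\,\omega\cdot\nabla f}{n-2}+f+tg\right)(x+t\omega)\,dS_\omega, \] \[ N(F)(x,t)=\frac{1}{(n-2)\omega_n}\int_0^t(t-\tau)\,d\tau\int_{|\omega|=1}F(x+(t-\tau)\omega,\tau)\,dS_\omega . \] Then $u$ satisfies the initial value problem \[ \begin{cases} \partial_t^2u(x,t)-\Delta u(x,t)=F(x,t)-H(x,t) & \text{in } \mathbb{R}^n\times[0,\infty),\\ u(x,0)=\varepsilon f(x),\quad u_t(x,0)=\varepsilon g(x), & x\in\mathbb{R}^n, \end{cases} \] where \[ \begin{aligned} H(x,t)=&\frac{n-3}{(n-2)\omega_n}\int_0^t d\tau\int_{|\omega|=1}(\partial_tF)(x+(t-\tau)\omega,\tau)\,dS_\omega +\frac{n-3}{(n-2)\omega_n}\int_{|\omega|=1}F(x+t\omega,0)\,dS_\omega\\ &+\frac{\varepsilon(n-3)}{(n-2)\omega_n}\int_{|\omega|=1}\left\{\Delta f+(n-2)\,\omega\cdot\nabla g\right\}(x+t\omega)\,dS_\omega . \end{aligned} \]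
   Context: $\omega_n=2\pi^{n/2}/\Gamma(n/2)$ denotes the surface measure of the unit sphere in $\mathbb{R}^n$, and $dS_\omega$ is the surface measure on the unit sphere $\{|\omega|=1\}$. *)

(* Defs.v *)
From mathcomp Require Import all_boot all_order all_algebra.
From mathcomp Require Import all_classical all_reals all_analysis.
Set Implicit Arguments.
Unset Strict Implicit.
Unset Printing Implicit Defensive.
Import Order.TTheory GRing.Theory Num.Theory.
Import numFieldNormedType.Exports.
Local Open Scope classical_set_scope.
Local Open Scope ring_scope.

Section Defs.
Variable R : realType.

Definition evec (n : nat) (i : 'I_n) : 'rV[R]_n := delta_mx 0 i.

(* ---------- Surface integral over the unit sphere S^{k} in R^{k+1} ----------
   Defined by spherical coordinates: S^0 = {1,-1} with counting measure, and
   int_{S^{k+1}} phi dS = int_0^pi sin(th)^k int_{S^k} phi(cos th, sin th eta) dS_eta dth. *)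
Fixpoint sph_int (k : nat) : ('rV[R]_k.+1 -> R) -> R :=
  match k with
  | 0%N => fun phi => phi (const_mx 1) + phi (const_mx (-1))
  | k'.+1 => fun phi =>
      \int[@lebesgue_measure R]_(th in `[0%R, pi]%classic)
        ((sin th) ^+ k' *
         sph_int (fun eta : 'rV[R]_k'.+1 =>
            phi (row_mx (const_mx (cos th) : 'rV[R]_1) (sin th *: eta))))
  end.

(* int_{|w|=1} phi(w) dS_w for w in R^n (the sphere of R^0 is empty). *)
Definition sphere_int (n : nat) : ('rV[R]_n -> R) -> R :=
  match n with
  | 0%N => fun _ => 0
  | k.+1 => @sph_int k
  end.

Definition omega (n : nat) : R := sphere_int (fun _ : 'rV[R]_n => 1).

Definition pderiv (n : nat) (i : 'I_n) (phi : 'rV[R]_n -> R) : 'rV[R]_n -> R :=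
  'D_(evec i) phi.

Definition wgrad (n : nat) (phi : 'rV[R]_n -> R) (w y : 'rV[R]_n) : R :=
  \sum_(i < n) w 0 i * pderiv i phi y.

Definition lap (n : nat) (phi : 'rV[R]_n -> R) (y : 'rV[R]_n) : R :=
  \sum_(i < n) pderiv i (pderiv i phi) y.

(* ---------- time derivatives on [0, +oo) ----------
   derivative within [0,+oo): two-sided for t > 0, right derivative at t = 0 *)
Definition tfilter (t : R) : set_system R :=
  within [set h : R | h != 0 /\ 0 <= t + h] (nbhs (0:R)).

Definition has_tderiv (phi : R -> R) (t l : R) : Prop :=
  (fun h => h^-1 * (phi (t + h) - phi t)) @ tfilter t --> l.

Definition tderiv (phi : R -> R) (t : R) : R :=
  lim ((fun h => h^-1 * (phi (t + h) - phi t)) @ tfilter t).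

Fixpoint Ck (n k : nat) (phi : 'rV[R]_n -> R) : Prop :=
  match k with
  | 0%N => continuous phi
  | k'.+1 => continuous phi /\ (forall x i, derivable phi x (evec i)) /\
             (forall i, Ck k' (pderiv i phi))
  end.

Definition hcont (n : nat) (F : 'rV[R]_n -> R -> R) : Prop :=
  {within [set p : 'rV[R]_n * R | 0 <= p.2], continuous (fun p => F p.1 p.2)}.

Fixpoint HCk (n k : nat) (F : 'rV[R]_n -> R -> R) : Prop :=
  match k with
  | 0%N => hcont F
  | k'.+1 => hcont F /\
      (forall x t i, 0 <= t -> derivable (F ^~ t) x (evec i)) /\
      (forall x t, 0 <= t -> exists l, has_tderiv (F x) t l) /\
      (forall i, HCk k' (fun x t => pderiv i (F ^~ t) x)) /\
      HCk k' (fun x t => tderiv (F x) t)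
  end.

Definition Vfun (n : nat) (f g : 'rV[R]_n -> R) (x : 'rV[R]_n) (t : R) : R :=
  (omega n)^-1 * sphere_int (fun w : 'rV[R]_n =>
     t * wgrad f w (x + t *: w) / (n%:R - 2) + f (x + t *: w) + t * g (x + t *: w)).

Definition NF (n : nat) (F : 'rV[R]_n -> R -> R) (x : 'rV[R]_n) (t : R) : R :=
  ((n%:R - 2) * omega n)^-1 *
  \int[@lebesgue_measure R]_(tau in `[0%R, t]%classic)
     ((t - tau) * sphere_int (fun w : 'rV[R]_n => F (x + (t - tau) *: w) tau)).

Definition Hfun (n : nat) (eps : R) (f g : 'rV[R]_n -> R) (F : 'rV[R]_n -> R -> R)
  (x : 'rV[R]_n) (t : R) : R :=
  (n%:R - 3) / ((n%:R - 2) * omega n) *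
    \int[@lebesgue_measure R]_(tau in `[0%R, t]%classic)
       (sphere_int (fun w : 'rV[R]_n => tderiv (F (x + (t - tau) *: w)) tau))
  + (n%:R - 3) / ((n%:R - 2) * omega n) *
    sphere_int (fun w : 'rV[R]_n => F (x + t *: w) 0)
  + eps * (n%:R - 3) / ((n%:R - 2) * omega n) *
    sphere_int (fun w : 'rV[R]_n =>
       lap f (x + t *: w) + (n%:R - 2) * wgrad g w (x + t *: w)).

End Defs.
Arguments evec {R n}.
Arguments omega {R}.

(* Main.v *)
(* The means [m(r) = int_{|w|=1} phi(x + r w) dS_w] satisfy Darboux's equation
   [r m'' + (n - 1) m' = r m(Delta phi)].  It follows from the tangential divergence theorem
   on the sphere, proved by induction on the dimension in the recursive spherical
   coordinates that define the surface integral: in the angle [theta] the integrand is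
   an exact derivative, up to the divergence theorem on the lower-dimensional sphere.
   With Darboux's equation, [t m' / (n - 2) + m] has time derivative [t m(Delta f) / (n - 2)],
   and [t m_g] and Duhamel's integral [N(F)] solve the wave equation up to multiples
   [n - 3] of first radial derivatives.  For [N(F)], integrating the total [tau]-derivative
   of [m(t - tau, tau)] along the backward cone turns [int m_r dtau] into the integral of
   [d_t F] and the boundary terms of [H]. *)
Require Import Defs.
From mathcomp Require Import all_boot all_order all_algebra.
From mathcomp Require Import all_classical all_reals all_analysis.
From mathcomp Require Import ring lra.
Import Order.TTheory GRing.Theory Num.Theory.
Import numFieldNormedType.Exports.
Local Open Scope classical_set_scope.
Local Open Scope ring_scope.
Set Implicit Arguments.
Unset Strict Implicit.
Unset Printing Implicit Defensive.

(** The sphere integral is defined by recursion in the polar angle. All that is used of it is this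
    recursion, its linearity on continuous functions and a bound by the supremum over a compact set;
    the last two already give differentiation under the integral sign. Likewise [Ck] and [HCk] speak
    of partial derivatives along the axes, so the chain rule and the symmetry of second derivatives
    are derived here from mean values and the fundamental theorem of calculus. The other obstacle is
    t = 0, where time derivatives are one-sided. The source is frozen for negative times and
    Duhamel's integral is continued below 0, so that the time functions to be differentiated have
    two-sided derivatives at 0. Darboux's equation stays multiplied by r, so it also covers the
    degenerate sphere r = 0. *)

Section Continuity.
Context {R : realType} {T : topologicalType}.

Lemma ctD {V : normedModType R} (f g : T -> V) :
  continuous f -> continuous g -> continuous (fun x => f x + g x).
Proof. by move=> cf cg x; apply: cvgD; [exact: cf | exact: cg]. Qed.

Lemma ctN {V : normedModType R} (f : T -> V) :
  continuous f -> continuous (fun x => - f x).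
Proof. by move=> cf x; apply: cvgN; exact: cf. Qed.

Lemma ctZ {V : normedModType R} (f : T -> R) (g : T -> V) :
  continuous f -> continuous g -> continuous (fun x => f x *: g x).
Proof. by move=> cf cg x; apply: cvgZ; [exact: cf | exact: cg]. Qed.

Lemma ctM (f g : T -> R) :
  continuous f -> continuous g -> continuous (fun x => f x * g x).
Proof. by move=> cf cg x; apply: cvgM; [exact: cf | exact: cg]. Qed.

Lemma ctX (f : T -> R) m : continuous f -> continuous (fun x => f x ^+ m).
Proof.
by move=> cf x; exact: (@continuous_comp _ _ _ f (fun y => y ^+ m) _ (cf x) (@exprn_continuous _ _ _)).
Qed.

Lemma ct_sum {V : normedModType R} (I : Type) (r : seq I) (f : I -> T -> V) :
  (forall i, continuous (f i)) -> continuous (fun x => \sum_(i <- r) f i x).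
Proof.
move=> cf; elim: r => [|i r IH].
  by under eq_fun do rewrite big_nil; exact: cst_continuous.
by under eq_fun do rewrite big_cons; exact: ctD.
Qed.

Lemma ct_comp {U W : topologicalType} (g : U -> W) (f : T -> U) :
  continuous g -> continuous f -> continuous (fun x => g (f x)).
Proof. by move=> cg cf x; apply: (continuous_comp (cf x)); exact: cg. Qed.

Lemma ct_pair {U W : topologicalType} (f : T -> U) (g : T -> W) :
  continuous f -> continuous g -> continuous (fun x => (f x, g x)).
Proof. by move=> cf cg x; apply: cvg_pair; [exact: cf | exact: cg]. Qed.

Lemma ct_app2 {U W X : topologicalType} (Phi : U -> W -> X) (f : T -> U) (g : T -> W) :
  continuous (fun q : U * W => Phi q.1 q.2) -> continuous f -> continuous g ->
  continuous (fun x => Phi (f x) (g x)).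
Proof.
by move=> cPhi cf cg; apply: (ct_comp cPhi (f := fun x => (f x, g x))); exact: ct_pair.
Qed.

Lemma ct_id : continuous (fun x : T => x).
Proof. by move=> x; exact: cvg_id. Qed.

Lemma ct_cst {U : topologicalType} (a : U) : continuous (fun _ : T => a).
Proof. by move=> x; exact: cvg_cst. Qed.

Lemma ct_fst {U W : topologicalType} (f : T -> U * W) :
  continuous f -> continuous (fun x => (f x).1).
Proof. by move=> cf x; apply: (continuous_comp (cf x)); exact: cvg_fst. Qed.

Lemma ct_snd {U W : topologicalType} (f : T -> U * W) :
  continuous f -> continuous (fun x => (f x).2).
Proof. by move=> cf x; apply: (continuous_comp (cf x)); exact: cvg_snd. Qed.

Lemma ct_coord m n (i : 'I_m) (j : 'I_n) (f : T -> 'M[R]_(m, n)) :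
  continuous f -> continuous (fun x => f x i j).
Proof.
by move=> cf x; exact: (@continuous_comp _ _ _ f (fun M : 'M[R]_(m, n) => M i j) _ (cf x) (@coord_continuous _ _ _ _ _ _)).
Qed.

Lemma cvg_row {U : Type} (F : set_system U) {FF : Filter F} n (f : U -> 'rV[R]_n) (l : 'rV[R]_n) :
  (forall i, f x 0 i @[x --> F] --> l 0 i) -> f x @[x --> F] --> l.
Proof.
move=> cf; apply/cvgrPdist_lt => e e0.
have : \forall y \near F, forall i, `|l 0 i - f y 0 i| < e.
  apply: filter_forall => i.
  by have /cvgrPdist_lt /(_ _ e0) := cf i; exact.
apply: filterS => y H.
rewrite [X in X < _]mx_normrE; apply/bigmax_ltP; split => // -[i j] _ /=.
by rewrite !mxE (ord1 i); exact: H.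
Qed.

Lemma ct_row n (f : T -> 'rV[R]_n) :
  (forall i, continuous (fun x => f x 0 i)) -> continuous f.
Proof. by move=> cf x; apply: cvg_row => i; exact: cf. Qed.

End Continuity.
Arguments ct_cst {T U}.

Ltac ctn := repeat first [ assumption | lazymatch goal with
  | |- continuous (fun _ => ?a) => exact: ct_cst
  | |- continuous (fun x => x) => exact: ct_id
  | |- continuous (fun x => @?f x + @?g x) => apply: (@ctD _ _ _ f g)
  | |- continuous (fun x => - @?f x) => apply: (@ctN _ _ _ f)
  | |- continuous (fun x => @?f x * @?g x) => apply: (@ctM _ _ f g)
  | |- continuous (fun x => @?f x *: @?g x) => apply: (@ctZ _ _ _ f g)
  | |- continuous (fun x => @?f x ^+ _) => apply: (@ctX _ _ f)
  | |- continuous fst => by move=> ?; exact: cvg_fst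
  | |- continuous snd => by move=> ?; exact: cvg_snd
  | |- continuous (fun x => (@?f x).1) => apply: (@ct_fst _ _ _ f)
  | |- continuous (fun x => (@?f x).2) => apply: (@ct_snd _ _ _ f)
  | |- continuous (fun x => (@?f x, @?g x)) => apply: (@ct_pair _ _ _ f g)
  | |- continuous (fun x => fun_of_matrix (@?f x) _ _) => apply: (@ct_coord _ _ _ _ _ _ f)
  | H : continuous (fun q => ?Phi q.1 q.2) |- continuous (fun x => ?Phi (@?f x) (@?g x)) =>
      apply: (@ct_app2 _ _ _ _ Phi f g H)
  | H : continuous ?g |- continuous (fun x => ?g (@?f x)) => apply: (@ct_comp _ _ _ g f H)
  | |- continuous (fun x => \sum_(i <- _) _) => apply: ct_sum => ?
  end ].

(** * Differentiation rules and a mean value theorem for increments of either sign *)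

Section Derivatives.
Context {R : realType}.

Lemma is_deriveP {V W : normedModType R} (f : V -> W) (a v : V) (df : W) :
  is_derive a v f df <-> h^-1 *: (f (a + h *: v) - f a) @[h --> 0^'] --> df.
Proof.
have E : (fun h : R => h^-1 *: (f (a + h *: v) - f a)) =
         (fun h => h^-1 *: ((f \o shift a) (h *: v) - f a)).
  by apply/funext => h; rewrite /= (addrC a).
rewrite E; split.
  by move=> [d <-]; exact: d.
move=> H; split; first by apply/cvg_ex; exists df.
by apply: cvg_lim => //; exact: norm_hausdorff.
Qed.

Lemma is_derive_line {V W : normedModType R} (f : V -> W) (a v : V) (s : R) (df : W) :
  is_derive (a + s *: v) v f df <-> is_derive s 1 (fun s => f (a + s *: v)) df.
Proof.
rewrite !is_deriveP.
suff -> : (fun h : R => h^-1 *: (f (a + s *: v + h *: v) - f (a + s *: v))) =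
  (fun h : R => h^-1 *: (f (a + (s + h *: 1) *: v) - f (a + s *: v))) by [].
by apply/funext => h; rewrite scalerDl addrA -[h *: 1]/(h * 1) mulr1.
Qed.

Lemma derD {V W : normedModType R} (f g : V -> W) x v a b :
  is_derive x v f a -> is_derive x v g b ->
  is_derive x v (fun x => f x + g x) (a + b).
Proof. by move=> ? ?; exact: is_deriveD. Qed.

Lemma derN {V W : normedModType R} (f : V -> W) x v a :
  is_derive x v f a -> is_derive x v (fun x => - f x) (- a).
Proof. by move=> ?; exact: is_deriveN. Qed.

Lemma derM {V : normedModType R} (f g : V -> R) x v a b :
  is_derive x v f a -> is_derive x v g b ->
  is_derive x v (fun x => f x * g x) (f x * b + a * g x).
Proof.
move=> df dg; have := @is_deriveM _ _ f g x v a b df dg.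
by rewrite -![_ *: _]/(_ * _) (mulrC (g x)).
Qed.

Lemma derZ {V : normedModType R} (c : R) (f : V -> R) x v a :
  is_derive x v f a -> is_derive x v (fun x => c * f x) (c * a).
Proof. by move=> ?; exact: is_deriveZ. Qed.

Lemma der_cst {V W : normedModType R} (c : W) (x v : V) :
  is_derive x v (fun=> c) 0.
Proof. exact: is_derive_cst. Qed.

Lemma der_id (x : R) : is_derive x 1 (fun x => x) 1.
Proof. exact: is_derive_id. Qed.

Lemma der_sum {V W : normedModType R} (I : Type) (r : seq I) (f : I -> V -> W) x v a :
  (forall i, is_derive x v (f i) (a i)) ->
  is_derive x v (fun x => \sum_(i <- r) f i x) (\sum_(i <- r) a i).
Proof.
move=> df; elim: r => [|i r IH].
  by under eq_fun do rewrite big_nil; rewrite big_nil; exact: der_cst.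
by under eq_fun do rewrite big_cons; rewrite big_cons; exact: derD.
Qed.

Lemma der_comp (f g : R -> R) (x a b : R) : is_derive (g x) 1 f a ->
  is_derive x 1 g b -> is_derive x 1 (fun x => f (g x)) (b * a).
Proof. by move=> ? ?; rewrite mulrC; exact: is_derive1_comp. Qed.

Lemma derX {V : normedModType R} (f : V -> R) m x v a :
  is_derive x v f a -> is_derive x v (fun x => f x ^+ m) (m%:R * f x ^+ m.-1 * a).
Proof.
move=> df; rewrite (_ : (fun x => _) = f ^+ m); first exact: is_deriveX.
apply/funext => y; elim: m => [|m IH]; first by rewrite !expr0.
by rewrite !exprS IH.
Qed.

Lemma der_near {V W : normedModType R} (f g : V -> W) x v a :
  v != 0 -> (\forall y \near x, f y = g y) -> is_derive x v f a -> is_derive x v g a.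
Proof. by move=> v0 H; apply: near_eq_is_derive. Qed.

Lemma is_derive_continuous1 (f : R -> R) (x a : R) :
  is_derive x 1 f a -> {for x, continuous f}.
Proof. by move=> [d _]; apply/differentiable_continuous/derivable1_diffP. Qed.

(** Difference quotients have increments of both signs; bounding the intermediate point by
    [|c| <= |s|] treats them, and [s = 0], in one statement. *)
Lemma MVT_abs (f f' : R -> R) (s : R) :
  (forall c : R, `|c| <= `|s| -> is_derive c 1 f (f' c)) ->
  exists2 c, `|c| <= `|s| & f s - f 0 = s * f' c.
Proof.
move=> df; have [s0|s0] := leP 0 s.
- have cf (x : R) : `|x| <= `|s| -> {for x, continuous f}.
    by move=> xs; exact: is_derive_continuous1 (df _ xs).
  have [||c cs E] := @MVT_segment R f f' 0 s s0.
  + by move=> x; rewrite in_itv/= => /andP[x0 xs]; apply: df; rewrite !ger0_norm // ltW.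
  + apply: derivable_within_continuous => x; rewrite in_itv/= => /andP[x0 xs].
    by apply: (@ex_derive _ _ _ _ _ _ (f' x)); apply: df; rewrite !ger0_norm.
  + exists c; last by rewrite E subr0 mulrC.
    by move: cs; rewrite in_itv/= => /andP[x0 xs]; rewrite !ger0_norm.
- have s0' := ltW s0.
  have [||c cs E] := @MVT_segment R f f' s 0 s0'.
  + by move=> x; rewrite in_itv/= => /andP[x0 xs]; apply: df;
      rewrite !ler0_norm // ?lerN2 ltW.
  + apply: derivable_within_continuous => x; rewrite in_itv/= => /andP[x0 xs].
    by apply: (@ex_derive _ _ _ _ _ _ (f' x)); apply: df; rewrite !ler0_norm ?lerN2.
  + exists c; last by rewrite -opprB E sub0r; ring.
    by move: cs; rewrite in_itv/= => /andP[x0 xs]; rewrite !ler0_norm ?lerN2.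
Qed.

End Derivatives.

(** * Bounded linear functionals on continuous functions: continuity and differentiation in a
    parameter *)

Section Radon.
Context {R : realType} {T : topologicalType} (K : set T) (J : (T -> R) -> R).

(** The common abstraction of the integral over a segment and of the sphere integral, so that
    parameter dependence is treated once for both. *)
Record radon : Prop := Radon {
  radonK : compact K;
  radonD : forall f g : T -> R, continuous f -> continuous g ->
    J (fun w => f w + g w) = J f + J g;
  radonZ : forall (c : R) (f : T -> R), continuous f -> J (fun w => c * f w) = c * J f;
  radon_bound : exists2 C, 0 <= C & forall (f : T -> R) (M : R), continuous f ->
    (forall w, K w -> `|f w| <= M) -> `|J f| <= C * M }.

Hypothesis rJ : radon.

Lemma radonN (f : T -> R) : continuous f -> J (fun w => - f w) = - J f.
Proof.
move=> cf; rewrite -mulN1r -(radonZ rJ)//; congr J.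
by apply/funext => w; rewrite mulN1r.
Qed.

Lemma radonB (f g : T -> R) : continuous f -> continuous g ->
  J (fun w => f w - g w) = J f - J g.
Proof. by move=> cf cg; rewrite (radonD rJ) ?radonN//; exact: ctN. Qed.

Lemma radonZr (c : R) (f : T -> R) : continuous f -> J (fun w => f w * c) = J f * c.
Proof.
move=> cf; rewrite mulrC -(radonZ rJ)//; congr J.
by apply/funext => w; rewrite mulrC.
Qed.

Lemma radon0 : J (fun=> 0) = 0.
Proof.
have /= E := radonZ rJ 0 (@ct_cst T R 0).
transitivity (J (fun=> 0 * 0)); last by rewrite E mul0r.
by congr J; apply/funext => w; rewrite mul0r.
Qed.

Lemma radon_sum (I : Type) (r : seq I) (f : I -> T -> R) :
  (forall i, continuous (f i)) ->
  J (fun w => \sum_(i <- r) f i w) = \sum_(i <- r) J (f i).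
Proof.
move=> cf; elim: r => [|i r IH].
  by under eq_fun do rewrite big_nil; rewrite big_nil radon0.
under eq_fun do rewrite big_cons; rewrite big_cons (radonD rJ) ?IH//.
exact: ct_sum.
Qed.

(** Tube lemma: joint continuity gives a neighbourhood of [p] for each [w], and compactness of [K]
    makes it uniform. Both [f p w'] and [f q w'] are compared with [f p w]. *)
Lemma near_compact_uniform {P : topologicalType} (f : P -> T -> R) (p : P) (e : R) :
  0 < e -> continuous (fun q : P * T => f q.1 q.2) ->
  \forall q \near p, forall w, K w -> `|f p w - f q w| < e.
Proof.
move=> e0 cf.
have /compact_near_coveringP := radonK rJ.
move=> /(_ P (nbhs p) (fun q w => `|f p w - f q w| < e) _); apply => w Kw.
have e20 : 0 < e / 2 by rewrite divr_gt0.
have /cvgrPdist_lt /(_ _ e20) H := cf (p, w).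
case: H => -[A B] /= [nA nB] H.
exists (B, A); first by split.
case=> w' q [/= Bw' Aq].
have := H (q, w') (conj Aq Bw').
have := H (p, w') (conj (nbhs_singleton nA) Bw') => /= H1 H2.
rewrite (splitr e) (le_lt_trans _ (ltrD H1 H2))//.
rewrite (_ : f p w' - f q w' = (f p w - f q w') - (f p w - f p w')); last by ring.
by rewrite [leRHS]addrC ler_normB.
Qed.

Lemma ct_slice {P : topologicalType} {W : topologicalType} (f : P -> T -> W) p :
  continuous (fun q : P * T => f q.1 q.2) -> continuous (f p).
Proof.
move=> cf; apply: (@ct_comp _ _ _ (fun q : P * T => f q.1 q.2) (fun w => (p, w))) => //.
by ctn.
Qed.

Lemma radon_continuous {P : topologicalType} (f : P -> T -> R) :
  continuous (fun q : P * T => f q.1 q.2) -> continuous (fun p => J (f p)).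
Proof.
move=> cf p; apply/cvgrPdist_le => e e0.
have [C C0 HC] := radon_bound rJ.
(* The bound [C] may be 0, so [e] is divided by [C + 1]. *)
have C1 : 0 < C + 1 by rewrite ltr_wpDl.
have eC : 0 < e / (C + 1) by rewrite divr_gt0.
have cfs q : continuous (f q) := ct_slice cf.
have := near_compact_uniform p eC cf.
apply: filterS => q H.
rewrite -radonB//.
rewrite (le_trans (HC _ (e / (C + 1)) _ _))//.
- by ctn.
- by move=> w Kw; exact/ltW/H.
- by rewrite mulrCA ger_pMr// ler_pdivrMr// mul1r lerDl.
Qed.

(** By the mean value theorem each difference quotient is a value of [f'] at a point depending on
    [w], and these values approach [f' y w] uniformly on [K]. Derivatives are asked only near [y] on
    the line along [v]: the source is differentiable in time only at positive times. *)
Lemma radon_derive {V : normedModType R} (f f' : V -> T -> R) (y v : V) :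
  (\forall s \near (0 : R), forall w, 
     is_derive (y + s *: v) v (fun y => f y w) (f' (y + s *: v) w)) ->
  continuous (fun q : V * T => f q.1 q.2) ->
  continuous (fun q : V * T => f' q.1 q.2) ->
  is_derive y v (fun y => J (f y)) (J (f' y)).
Proof.
move=> df cf cf'; apply/is_deriveP/cvgrPdist_le => e e0.
have [C C0 HC] := radon_bound rJ.
have C1 : 0 < C + 1 by rewrite ltr_wpDl.
have eC : 0 < e / (C + 1) by rewrite divr_gt0.
have cfs q : continuous (f q) := ct_slice cf.
have cfs' q : continuous (f' q) := ct_slice cf'.
have cfv : continuous (fun q : R * T => f' (y + q.1 *: v) q.2).
  apply: (@ct_comp _ _ _ (fun q : V * T => f' q.1 q.2)
    (fun q : R * T => (y + q.1 *: v, q.2))) => //.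
  by ctn.
have /= U := @near_compact_uniform R (fun s w => f' (y + s *: v) w) 0 _ eC cfv.
have /nbhs_ballP[d /= d0 B] : \forall s \near (0 : R),
    (forall w, is_derive (y + s *: v) v (fun y => f y w) (f' (y + s *: v) w)) /\
    (forall w, K w -> `|f' (y + 0 *: v) w - f' (y + s *: v) w| < e / (C + 1)).
  exact: filterI df U.
rewrite /dnbhs near_withinE; apply/nbhs_ballP; exists d => // s.
rewrite /ball /= sub0r normrN => sd s0.
rewrite -[_^-1 *: _]/(_ * _) -radonB//.
rewrite -(radonZ rJ); last by ctn.
rewrite -radonB//; last by ctn.
rewrite (le_trans (HC _ (e / (C + 1)) _ _))//.
- by ctn.
- move=> w Kw.
  have [|c cs] := @MVT_abs _ (fun s => f (y + s *: v) w) (fun s => f' (y + s *: v) w) s.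
    move=> c cs; apply/(is_derive_line (fun y => f y w)).
    by apply: (B c _).1; rewrite /ball/= sub0r normrN (le_lt_trans cs).
  rewrite scale0r addr0 => ->.
  rewrite mulKf//.
  have Bc : ball 0 d c by rewrite /ball/= sub0r normrN (le_lt_trans cs).
  by have := (B c Bc).2 w Kw; rewrite scale0r addr0 => /ltW.
- by rewrite mulrCA ger_pMr// ler_pdivrMr// mul1r lerDl.
Qed.

Lemma radon_derive_all {V : normedModType R} (f f' : V -> T -> R) (y v : V) :
  (forall y w, is_derive y v (fun y => f y w) (f' y w)) ->
  continuous (fun q : V * T => f q.1 q.2) ->
  continuous (fun q : V * T => f' q.1 q.2) ->
  is_derive y v (fun y => J (f y)) (J (f' y)).
Proof.
move=> df; apply: radon_derive.
by apply/nbhs_ballP; exists 1 => //= s _ w; exact: df.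
Qed.

End Radon.

(** * Integrals over segments and the fundamental theorem of calculus *)

Section Interval.
Context {R : realType}.
Notation mu := (@lebesgue_measure R).

Lemma integrable_itv (f : R -> R) (a b : R) :
  continuous f -> mu.-integrable `[a, b] (EFin \o f).
Proof.
move=> cf; apply: continuous_compact_integrable; first exact: segment_compact.
exact: continuous_subspaceT.
Qed.

Lemma radon_itv (a b : R) :
  radon `[a, b]%classic (fun f => \int[mu]_(x in `[a, b]%classic) f x).
Proof.
split.
- exact: segment_compact.
- by move=> f g cf cg; apply: RintegralD => //; exact: integrable_itv.
- by move=> c f cf; apply: RintegralZl => //; exact: integrable_itv.
- exists (fine (mu `[a, b]%classic)); first exact: fine_ge0.
  move=> f M cf fM; rewrite mulrC -Rintegral_cst//.
  apply: (le_trans (le_normr_Rintegral _ (integrable_itv a b cf))) => //.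
  apply: le_Rintegral => //; apply: integrable_itv.
    by move=> x; apply: cvg_norm; exact: cf.
  exact: ct_cst.
Qed.

Lemma Rintegral_split (f : R -> R) (a b c : R) : a <= b -> b <= c -> continuous f ->
  \int[mu]_(x in `[b, c]%classic) f x =
  \int[mu]_(x in `[a, c]%classic) f x - \int[mu]_(x in `[a, b]%classic) f x.
Proof.
move=> ab bc cf; rewrite (Rintegral_itvB (integrable_itv a c cf)) ?bnd_simp//.
rewrite Rintegral_itv_obnd_cbnd//.
by apply: (integrableS _ _ _ (integrable_itv b c cf)) => //; exact: subset_itv_oc_cc.
Qed.

(** The strict inequality gives a two-sided derivative; this is why later primitives needed at 0
    start at -1. *)
Lemma primitive_derive (f : R -> R) (a x : R) : a < x -> continuous f ->
  is_derive x 1 (fun x => \int[mu]_(t in `[a, x]%classic) f t) (f x).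
Proof.
move=> ax cf.
have xu : x < x + 1 by rewrite ltrDl.
have [d] := continuous_FTC1_closed xu (integrable_itv a (x + 1) cf) ax (cf x).
by rewrite derive1E => E; split.
Qed.

(** Differentiability only in the open interval matters at the poles of the sphere, where [sin]
    vanishes, and at the initial time of the backward cone. *)
Lemma FTC (f f' : R -> R) (a b : R) : a <= b -> continuous f -> continuous f' ->
  (forall x : R, a < x < b -> is_derive x 1 f (f' x)) ->
  \int[mu]_(x in `[a, b]%classic) f' x = f b - f a.
Proof.
rewrite le_eqVlt => /predU1P[->|ab] cf cf' df.
  by rewrite set_itv1 Rintegral_set1 subrr.
rewrite /Rintegral (@continuous_FTC2 _ f' f)//.
- exact: continuous_subspaceT.
- split.
  + by move=> x; rewrite in_itv/= => /df [].
  + exact/cvg_at_right_filter/cf.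
  + exact/cvg_at_left_filter/cf.
- by move=> x; rewrite in_itv/= derive1E => /df [].
Qed.

End Interval.

(** * The recursive sphere integral as a bounded functional; positivity of the surface measure *)

Section Sphere.
Context {R : realType}.
Notation mu := (@lebesgue_measure R).

Definition spherical k (th : R) (eta : 'rV[R]_k.+1) : 'rV[R]_k.+2 :=
  row_mx (const_mx (cos th) : 'rV[R]_1) (sin th *: eta).

Lemma spherical0 k th (eta : 'rV[R]_k.+1) : spherical th eta 0 0 = cos th.
Proof.
have E : (0 : 'I_k.+2) = lshift k.+1 (0 : 'I_1) by apply/val_inj.
by rewrite /spherical [in LHS]E (row_mxEl (const_mx (cos th) : 'rV[R]_1)) mxE.
Qed.

Lemma sphericalS k th (eta : 'rV[R]_k.+1) i :
  spherical th eta 0 (lift 0 i) = sin th * eta 0 i.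
Proof.
have E : (lift 0 i : 'I_k.+2) = rshift 1 i by apply/val_inj.
by rewrite /spherical [in LHS]E (row_mxEr (const_mx (cos th) : 'rV[R]_1)) mxE.
Qed.

Lemma spherical_continuous k (T : topologicalType) (a : T -> R) (b : T -> 'rV[R]_k.+1) :
  continuous a -> continuous b -> continuous (fun x => spherical (a x) (b x)).
Proof.
move=> ca cb; apply: ct_row => i; case: (unliftP 0 i) => [j|] ->.
  rewrite (_ : (fun x => _) = (fun x => sin (a x) * b x 0 j)); last first.
    by apply/funext => x; rewrite sphericalS.
  by ctn; apply: (ct_comp (g := sin)) => //; exact: continuous_sin.
rewrite (_ : (fun x => _) = (fun x => cos (a x))); last first.
  by apply/funext => x; rewrite spherical0.
by apply: (ct_comp (g := cos)) => //; exact: continuous_cos.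
Qed.

Lemma ct_spherical k (f : 'rV[R]_k.+2 -> R) : continuous f ->
  continuous (fun q : R * 'rV[R]_k.+1 => f (spherical q.1 q.2)).
Proof.
move=> cf; apply: (ct_comp (g := f)) => //.
by apply: spherical_continuous => p; [exact: cvg_fst | exact: cvg_snd].
Qed.

Lemma ct_spherical_slice k (f : 'rV[R]_k.+2 -> R) (th : R) : continuous f ->
  continuous (fun eta : 'rV[R]_k.+1 => f (spherical th eta)).
Proof.
move=> cf; apply: (ct_comp (g := f)) => //.
by apply: spherical_continuous; [exact: ct_cst | exact: ct_id].
Qed.

(** The compact set carrying the sphere integral. Coordinate bounds pass through [spherical] at
    once, since [|cos|] and [|sin|] are at most 1. *)
Definition box n : set 'rV[R]_n := [set w : 'rV[R]_n | forall i, `[-1, 1]%classic (w ord0 i)].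

Lemma box_compact n : compact (@box n).
Proof. by apply: (@rV_compact R n (fun=> `[-1, 1]%classic)) => i; exact: segment_compact. Qed.

Lemma sph_intS k (f : 'rV[R]_k.+2 -> R) : sph_int f =
  \int[mu]_(th in `[0, pi]%classic) (sin th ^+ k * sph_int (fun eta => f (spherical th eta))).
Proof. by []. Qed.

Lemma radon_sph k : radon (@box k.+1) (@sph_int R k).
Proof.
elim: k => [|k IH].
  split; first exact: box_compact.
  - by move=> f g _ _ /=; ring.
  - by move=> c f _ /=; ring.
  - exists 2 => // f M _ fM /=.
    apply: le_trans (ler_normD _ _) _.
    rewrite mulr_natl mulr2n lerD// fM// => i /=; rewrite in_itv/= mxE; lra.
have ct_integrand (f : 'rV[R]_k.+2 -> R) : continuous f ->
    continuous (fun th => sin th ^+ k * sph_int (fun eta => f (spherical th eta))).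
  move=> cf; apply: ctM; first by apply: ctX; exact: continuous_sin.
  exact: (radon_continuous IH (ct_spherical cf)).
split; first exact: box_compact.
- move=> f g cf cg; rewrite !sph_intS -(radonD (radon_itv 0 pi)).
  + congr Rintegral; apply/funext => th.
    by rewrite (radonD IH) ?mulrDr//; exact: ct_spherical_slice.
  + exact: ct_integrand.
  + exact: ct_integrand.
- move=> c f cf; rewrite !sph_intS -(radonZ (radon_itv 0 pi)); last exact: ct_integrand.
  congr Rintegral; apply/funext => th.
  by rewrite (radonZ IH) 1?mulrCA//; exact: ct_spherical_slice.
- have [C C0 HC] := radon_bound IH.
  have [D D0 HD] := radon_bound (radon_itv 0 (pi : R)).
  exists (D * C); first exact: mulr_ge0.
  move=> f M cf fM; rewrite sph_intS -mulrA; apply: HD; first exact: ct_integrand.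
  move=> th _; rewrite normrM normrX.
  rewrite (@le_trans _ _ (1 * `|sph_int (fun eta => f (spherical th eta))|))//.
    by rewrite ler_wpM2r// exprn_ile1// ler_norml sin_geN1 sin_le1.
  rewrite mul1r; apply: HC; first exact: ct_spherical_slice.
  move=> eta boxeta; apply: fM => i /=; rewrite in_itv/= -ler_norml.
  case: (unliftP 0 i) => [j|] ->.
    rewrite sphericalS normrM mulr_ile1// ler_norml ?sin_geN1 ?sin_le1//.
    by have := boxeta j; rewrite /= in_itv.
  by rewrite spherical0 ler_norml cos_geN1 cos_le1.
Qed.

Lemma ct_sph_integrand k (f : 'rV[R]_k.+2 -> R) : continuous f ->
  continuous (fun th => sin th ^+ k * sph_int (fun eta => f (spherical th eta))).
Proof.
move=> cf; apply: ctM; first by apply: ctX; exact: continuous_sin.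
exact: (radon_continuous (@radon_sph k) (ct_spherical cf)).
Qed.

Lemma sph_int1_gt0 k : 0 < sph_int (fun _ : 'rV[R]_k.+1 => 1).
Proof.
elim: k => [|k IH]; first by rewrite /= addr_gt0.
rewrite sph_intS; set c := sph_int _ in IH *.
have cf : continuous (fun th : R => sin th ^+ k * c).
  by ctn; exact: continuous_sin.
(* The primitive starts at -1 to be differentiable at 0 as well. The mean value theorem then writes
   the integral as [pi] times an interior value of the integrand, where [sin] is positive. *)
have N10 : (-1 : R) <= 0 by exact: lerN10.
rewrite (Rintegral_split N10 (pi_ge0 R))//.
set P := fun x : R => \int[mu]_(th in `[-1, x]%classic) (sin th ^+ k * c).
rewrite -[_ - _]/(P pi - P 0).
have dP (x : R) : 0 <= x -> is_derive x 1 P (sin x ^+ k * c).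
  by move=> x0; apply: (primitive_derive (f := fun th => sin th ^+ k * c)) => //; exact: lt_le_trans x0.
have [||x] := @MVT R P (fun x => sin x ^+ k * c) 0 pi (pi_gt0 R).
- by move=> x; rewrite in_itv/= => /andP[/ltW x0 _]; exact: dP.
- apply: derivable_within_continuous => x; rewrite in_itv/= => /andP[x0 _].
  by have [] := dP x x0.
rewrite in_itv/= => x0pi ->; rewrite subr0 !mulr_gt0 ?pi_gt0//.
by rewrite exprn_gt0// sin_gt0_pi.
Qed.

End Sphere.

(** * Chain rules from continuous partial derivatives *)

Section Curves.
Context {R : realType}.

(** The way from [y] to [y + v] changes one coordinate at a time, so each partial derivative gets
    its own intermediate point [xi i]. *)
Lemma mean_value_coord n (h : 'rV[R]_n -> R) (dh : 'I_n -> 'rV[R]_n -> R) :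
  (forall i y, is_derive y (evec i) h (dh i y)) ->
  forall y v : 'rV[R]_n, exists2 xi : 'I_n -> 'rV[R]_n,
    (forall i j, `|xi i 0 j - y 0 j| <= `|v 0 j|) &
    h (y + v) - h y = \sum_i v 0 i * dh i (xi i).
Proof.
move=> dhP y v.
(* [p k] has its first [k] coordinates moved already; the increments of [h] along [p] telescope. *)
pose p k := y + \row_j (if (j < k)%N then v 0 j else 0).
have pE k j : p k 0 j = y 0 j + (if (j < k)%N then v 0 j else 0) by rewrite !mxE.
have eE i j c : (c *: evec i : 'rV[R]_n) 0 j = c * (j == i)%:R by rewrite !mxE.
have step (i : 'I_n) : exists x : 'rV[R]_n,
    (forall j, `|x 0 j - y 0 j| <= `|v 0 j|) /\
    h (p i.+1) - h (p i) = v 0 i * dh i x.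
  have [|c cv] := @MVT_abs R (fun s => h (p i + s *: evec i))
    (fun s => dh i (p i + s *: evec i)) (v 0 i).
    by move=> c _; apply: (is_derive_line h (p i) (evec i) c _).1; exact: dhP.
  rewrite scale0r addr0 => E; exists (p i + c *: evec i); split.
    move=> j; rewrite [X in `|X - _|]mxE pE eE -addrA addrC addrA subrK.
    have [->|ji] := eqVneq j i; first by rewrite ltnn addr0 mulr1.
    by rewrite mulr0 add0r; case: ifP => //; rewrite normr0.
  rewrite -E; congr (h _ - _); apply/rowP => j; rewrite [RHS]mxE !pE eE -addrA; congr (_ + _).
  rewrite ltnS leq_eqVlt; have [->|ji] := eqVneq j i.
    by rewrite eqxx ltnn /= mulr1 add0r.
  by rewrite (_ : (j == i :> nat) = false) ?mulr0 ?addr0//; exact/negbTE.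
have [xi xiP] := choice step.
exists xi; first by move=> i; exact: (xiP i).1.
under eq_bigr => i _ do rewrite -(xiP i).2.
rewrite -(big_mkord xpredT (fun k => h (p k.+1) - h (p k))) telescope_sumr//.
congr (h _ - h _).
  by congr (_ + _); apply/rowP => j; rewrite mxE ltn_ord.
by rewrite /p (_ : \row__ _ = 0) ?addr0//; apply/rowP => j; rewrite !mxE.
Qed.

(** The increment is split at [H (t + h) (c t)]: the space increment is taken at the later time
    [t + h], where joint continuity of [dH] controls it, so the time derivative enters only at the
    fixed point [c t]. *)
Lemma chain_rule_time n (H : R -> 'rV[R]_n -> R) (dH : 'I_n -> R -> 'rV[R]_n -> R)
    (c : R -> 'rV[R]_n) (c' : 'I_n -> R) (t b : R) :
  (forall i s y, is_derive y (evec i) (H s) (dH i s y)) ->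
  (forall i, continuous (fun p : R * 'rV[R]_n => dH i p.1 p.2)) ->
  (forall i, is_derive t 1 (fun s => c s 0 i) (c' i)) ->
  is_derive t 1 (fun s => H s (c t)) b ->
  is_derive t 1 (fun s => H s (c s)) (b + \sum_i c' i * dH i t (c t)).
Proof.
move=> dHP cdH dc dHt.
have /choice[xi xiP] (h : R) : exists xi : 'I_n -> 'rV[R]_n,
    (forall i j, `|xi i 0 j - c t 0 j| <= `|c (t + h) 0 j - c t 0 j|) /\
    H (t + h) (c (t + h)) - H (t + h) (c t) =
      \sum_i (c (t + h) 0 i - c t 0 i) * dH i (t + h) (xi i).
  have [xi xi1 xi2] := mean_value_coord (fun i y => dHP i (t + h) y) (c t) (c (t + h) - c t).
  exists xi; split.
    by move=> i j; apply: le_trans (xi1 i j) _; rewrite !mxE.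
  rewrite (_ : c t + (c (t + h) - c t) = c (t + h)) in xi2; last by rewrite addrC subrK.
  by rewrite xi2; apply: eq_bigr => i _; rewrite !mxE.
apply/is_deriveP.
rewrite (_ : (fun h : R => _) = (fun h : R =>
   h^-1 * (H (t + h) (c t) - H t (c t)) +
   \sum_i (h^-1 * (c (t + h) 0 i - c t 0 i)) * dH i (t + h) (xi h i))); last first.
  apply/funext => h; rewrite -[h *: 1]/(h * 1) mulr1 -[_ *: _]/(_ * _).
  under [in RHS]eq_bigr do rewrite -mulrA.
  by rewrite -mulr_sumr -(xiP h).2 -mulrDr; congr (_ * _); ring.
have th : t + h @[h --> (0 : R)^'] --> t.
  rewrite -[X in _ --> X]addr0; apply: cvgD; first exact: cvg_cst.
  exact: nbhs_dnbhs.
have slope (f : R -> R) a : is_derive t 1 f a ->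
    h^-1 * (f (t + h) - f t) @[h --> (0 : R)^'] --> a.
  move=> /is_deriveP; apply: cvg_trans; apply: near_eq_cvg; near=> h.
  by rewrite -[h *: 1]/(h * 1) mulr1.
apply: cvgD; first exact: slope dHt.
apply: cvg_big => [|i _]; first exact: add_continuous.
apply: cvgM; first exact: slope (dc i).
suff xit : (t + h, xi h i) @[h --> (0 : R)^'] --> (t, c t).
  exact: (@cvg_comp _ _ _ (fun h => (t + h, xi h i))
    (fun p : R * 'rV[R]_n => dH i p.1 p.2) _ (nbhs (t, c t)) _ xit (cdH i (t, c t))).
apply: (@cvg_pair _ _ _ _ (nbhs t) (nbhs (c t))); first exact: th.
apply: cvg_row => j.
have cj : c (t + h) 0 j @[h --> (0 : R)^'] --> c t 0 j.
  apply: (@cvg_comp _ _ _ (fun h => t + h) (fun s => c s 0 j) _ (nbhs t)) => //.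
  exact: is_derive_continuous1 (dc j).
apply/cvgrPdist_lt => e e0.
move/cvgrPdist_lt : cj => /(_ _ e0).
apply: filterS => h; rewrite distrC (distrC (c t 0 j)); apply: le_lt_trans.
exact: (xiP h).1.
Unshelve. all: by end_near. Qed.

Lemma chain_rule n (h : 'rV[R]_n -> R) (dh : 'I_n -> 'rV[R]_n -> R)
    (c : R -> 'rV[R]_n) (c' : 'I_n -> R) (t : R) :
  (forall i y, is_derive y (evec i) h (dh i y)) -> (forall i, continuous (dh i)) ->
  (forall i, is_derive t 1 (fun s => c s 0 i) (c' i)) ->
  is_derive t 1 (fun s => h (c s)) (\sum_i c' i * dh i (c t)).
Proof.
move=> dhP cdh dc; rewrite -[X in is_derive _ _ _ X]add0r.
apply: (chain_rule_time (H := fun=> h) (dH := fun i _ => dh i)) => //.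
- by move=> i; apply: (ct_comp (g := dh i)) => // p; exact: cvg_snd.
- exact: der_cst.
Qed.

End Curves.

Record C1 (R : realType) n (h : 'rV[R]_n -> R) (dh : 'I_n -> 'rV[R]_n -> R) : Prop := {
  C1_der : forall i y, is_derive y (evec i) h (dh i y);
  C1_ct : continuous h;
  C1_dct : forall i, continuous (dh i) }.
Arguments C1_der {R n h dh}.
Arguments C1_ct {R n h dh}.
Arguments C1_dct {R n h dh}.

(** * The tangential divergence theorem on the unit sphere *)

Section SphereDivergence.
Context {R : realType}.

Section Step.
Variables (k : nat) (h : 'rV[R]_k.+2 -> R) (dh : 'I_k.+2 -> 'rV[R]_k.+2 -> R).
Hypothesis hC1 : C1 h dh.

(** The derivative of [h] in the direction [(0, eta)]. The meridian has tangent
    [(- sin th, cos th *: eta)] and position [(cos th, sin th *: eta)], so [dh 0] and [radial]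
    express the derivatives along both. *)
Definition radial (th : R) (eta : 'rV[R]_k.+1) := \sum_j eta 0 j * dh (lift 0 j) (spherical th eta).

Lemma ct_radial th : continuous (radial th).
Proof. by rewrite /radial; ctn; exact: ct_spherical_slice (C1_dct hC1 _). Qed.

Lemma ct_radial2 : continuous (fun q : R * 'rV[R]_k.+1 => radial q.1 q.2).
Proof.
rewrite /radial; apply: ct_sum => i; apply: ctM; last exact: ct_spherical (C1_dct hC1 _).
by apply: ct_coord => p; exact: cvg_snd.
Qed.

Lemma C1_slice th : C1 (fun eta => h (spherical th eta))
  (fun j eta => sin th * dh (lift 0 j) (spherical th eta)).
Proof.
split.
- move=> j eta.
  rewrite -{1}[eta]addr0 -(scale0r (evec j)).
  apply: (is_derive_line (fun eta => h (spherical th eta)) eta (evec j) 0 _).2.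
  have := @chain_rule R _ h dh (fun s => spherical th (eta + s *: evec j))
    (fun i => if unlift 0 i is Some l then sin th * (l == j)%:R else 0) 0
    (C1_der hC1) (C1_dct hC1).
  rewrite scale0r addr0 big_ord_recl unlift_none mul0r add0r.
  rewrite (bigD1 j)//= liftK eqxx mulr1 big1 ?addr0; last first.
    by move=> l lj; rewrite liftK (negbTE lj) mulr0 mul0r.
  apply => i; case: (unliftP 0 i) => [l|] ->.
    rewrite ?liftK (_ : (fun s => _) = (fun s => sin th * (eta 0 l + s * (l == j)%:R))).
      apply: derZ; rewrite -[X in is_derive _ _ _ X]add0r.
      apply: (derD (der_cst (eta 0 l) _ _)).
      rewrite [X in is_derive _ _ _ X](_ : _ = 0 * 0 + 1 * (l == j)%:R); last by ring.
      exact: derM (der_id 0) (der_cst _ _ _).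
    by apply/funext => s; rewrite sphericalS !mxE.
  rewrite ?unlift_none (_ : (fun s => _) = (fun=> cos th)); first exact: der_cst.
  by apply/funext => s; rewrite spherical0.
- exact: ct_spherical_slice (C1_ct hC1).
- by move=> i; ctn; exact: ct_spherical_slice (C1_dct hC1 _).
Qed.

Lemma derive_theta (th : R) eta : is_derive th 1 (fun th => h (spherical th eta))
  (- sin th * dh 0 (spherical th eta) + cos th * radial th eta).
Proof.
have := @chain_rule R _ h dh (fun s => spherical s eta)
    (fun i => if unlift 0 i is Some l then cos th * eta 0 l else - sin th) th
    (C1_der hC1) (C1_dct hC1).
rewrite big_ord_recl unlift_none.
rewrite (eq_bigr (fun l => cos th * (eta 0 l * dh (lift 0 l) (spherical th eta)))); last first.
  by move=> l _; rewrite liftK mulrA.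
rewrite -mulr_sumr; apply => i; case: (unliftP 0 i) => [l|] ->.
  rewrite ?liftK (_ : (fun s => _) = (fun s => sin s * eta 0 l)).
    rewrite [X in is_derive _ _ _ X](_ : _ = sin th * 0 + cos th * eta 0 l); last by ring.
    exact: derM (is_derive_sin th) (der_cst (eta 0 l) th 1).
  by apply/funext => s; rewrite sphericalS.
rewrite ?unlift_none (_ : (fun s => _) = cos); first exact: is_derive_cos.
by apply/funext => s; rewrite spherical0.
Qed.

Lemma derive_theta_sph (a : 'rV[R]_k.+1 -> R) (th : R) : continuous a ->
  is_derive th 1 (fun th => sph_int (fun eta => a eta * h (spherical th eta)))
  (- sin th * sph_int (fun eta => a eta * dh 0 (spherical th eta)) +
   cos th * sph_int (fun eta => a eta * radial th eta)).
Proof.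
move=> ca.
have r := @radon_sph R k.
rewrite -!(radonZ r); first last.
- by apply: ctM => //; exact: ct_radial.
- by apply: ctM => //; exact: ct_spherical_slice (C1_dct hC1 _).
rewrite -(radonD r); first last.
- by apply: ctM; [exact: ct_cst | apply: ctM => //; exact: ct_radial].
- apply: ctM; [exact: ct_cst | apply: ctM => //].
  exact: ct_spherical_slice (C1_dct hC1 _).
have ca2 : continuous (fun q : R * 'rV[R]_k.+1 => a q.2).
  by apply: (ct_comp (g := a)) => // p; exact: cvg_snd.
apply: (radon_derive_all r (f := fun th eta => a eta * h (spherical th eta))
  (f' := fun th eta => - sin th * (a eta * dh 0 (spherical th eta)) +
     cos th * (a eta * radial th eta))).
- move=> u eta.
  rewrite [X in is_derive _ _ _ X](_ : _ = a eta * 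
    (- sin u * dh 0 (spherical u eta) + cos u * radial u eta)); last by ring.
  by apply: derZ; exact: derive_theta.
- by apply: ctM => //; exact: ct_spherical (C1_ct hC1).
- have cs : continuous (fun q : R * 'rV[R]_k.+1 => sin q.1).
    by apply: (ct_comp (g := sin)); [exact: continuous_sin|move=> p; exact: cvg_fst].
  have cc : continuous (fun q : R * 'rV[R]_k.+1 => cos q.1).
    by apply: (ct_comp (g := cos)); [exact: continuous_cos|move=> p; exact: cvg_fst].
  apply: ctD.
    by apply: ctM; [exact: ctN | apply: ctM => //; exact: ct_spherical (C1_dct hC1 _)].
  by apply: ctM => //; apply: ctM => //; exact: ct_radial2.
Qed.

End Step.

(** For [k > 0] the power of [sin] vanishes. For [k = 0] it is 1, but both points of the 0-sphere
    are sent to the same pole, and the odd weight [eta 0 l] makes them cancel. *)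
Lemma sph_int_pole k (h : 'rV[R]_k.+2 -> R) (l : 'I_k.+1) (x : R) : sin x = 0 ->
  sin x ^+ k * cos x * sph_int (fun eta : 'rV[R]_k.+1 => eta 0 l * h (spherical x eta)) = 0.
Proof.
move=> s0; case: k h l => [|k] h l; last by rewrite s0 expr0n /= !mul0r.
by rewrite /= /spherical s0 !scale0r !mxE; ring.
Qed.

Lemma mulrn_expr_pred k (x : R) : k%:R * x ^+ k.-1 * x = k%:R * x ^+ k.
Proof. by case: k => [|k]; rewrite ?mul0r//= exprSr mulrA. Qed.

Ltac side := ctn; match goal with H : forall _, _ |- _ => exact: H end.

(* The tangential divergence theorem on the unit sphere of [R^(k+1)]; the last term is
   the mean curvature correction. *)
Lemma sphere_divergence k (h : 'rV[R]_k.+1 -> R) (dh : 'I_k.+1 -> 'rV[R]_k.+1 -> R) i :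
  C1 h dh ->
  sph_int (fun w => dh i w) =
  sph_int (fun w => w 0 i * \sum_j w 0 j * dh j w) + k%:R * sph_int (fun w => w 0 i * h w).
Proof.
move=> hC1; pose Q w := dh i w - w 0 i * (\sum_j w 0 j * dh j w) - k%:R * (w 0 i * h w).
have cdh := C1_dct hC1; have ch := C1_ct hC1.
(* Gathered in a single integrand, the identity unfolds to one integral in the polar angle. *)
suff : sph_int Q = 0.
  have r := @radon_sph R k.
  rewrite /Q (radonB r); [|by ctn; exact: cdh|by ctn].
  rewrite (radonB r); [|exact: cdh|by ctn; exact: cdh].
  rewrite (radonZ r); last by ctn.
  by move/eqP; rewrite subr_eq0 subr_eq addrC => /eqP.
rewrite {}/Q {cdh ch}.
elim: k h dh i hC1 => [|k IH] h dh i hC1.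
  by rewrite /= !big_ord1 !(ord1 i) !mxE; ring.
have r := @radon_sph R k.
have cdh th j : continuous (fun eta => dh j (spherical th eta)).
  exact: ct_spherical_slice (C1_dct hC1 j).
have ch th : continuous (fun eta => h (spherical th eta)).
  exact: ct_spherical_slice (C1_ct hC1).
have ch2 := ct_spherical (C1_ct hC1).
have crad := ct_radial hC1.
have sumE th eta : \sum_j spherical th eta 0 j * dh j (spherical th eta) =
    cos th * dh 0 (spherical th eta) + sin th * radial dh th eta.
  rewrite big_ord_recl spherical0; congr (_ + _).
  by rewrite mulr_sumr; apply: eq_bigr => j _; rewrite sphericalS mulrA.
have csin : continuous (@sin R) := @continuous_sin R.
have ccos : continuous (@cos R) := @continuous_cos R.
have sc (x : R) : cos x ^+ 2 = 1 - sin x ^+ 2 by rewrite -(cos2Dsin2 x) addrK.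
rewrite sph_intS.
pose G th := sin th ^+ k * sph_int (fun eta =>
    dh i (spherical th eta) -
    spherical th eta 0 i * (\sum_j spherical th eta 0 j * dh j (spherical th eta)) -
    k.+1%:R * (spherical th eta 0 i * h (spherical th eta))).
rewrite -[LHS]/(\int[lebesgue_measure]_(th in `[0, pi]%classic) G th).
have cQ : continuous G.
  apply: (ct_sph_integrand (f := fun w =>
    dh i w - w 0 i * (\sum_j w 0 j * dh j w) - k.+1%:R * (w 0 i * h w))).
  by ctn; [exact: C1_dct hC1 _|exact: C1_dct hC1 _|exact: C1_ct hC1].
case: (unliftP 0 i) @G cQ => [l|] ->{i} G cQ; last first.
  (* Polar component: the tangential part of the first basis vector points along the meridians, so
     the integrand is the exact derivative of this flux, which vanishes at both poles. *)
  pose f th := - (sin th ^+ k.+1 * sph_int (fun eta => 1 * h (spherical th eta))).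
  have cf : continuous f.
    rewrite /f; ctn; apply: (radon_continuous r (f := fun th eta => 1 * h (spherical th eta))).
    by ctn.
  suff df (x : R) : 0 < x < pi -> is_derive x 1 f (G x).
    by rewrite (FTC (pi_ge0 R) cf cQ df) /f sinpi sin0 exprS; ring.
  move=> _; rewrite /G.
  have c1 : continuous (fun _ : 'rV[R]_k.+1 => 1 : R) by exact: ct_cst.
  under eq_fun do rewrite sumE spherical0.
  have D := derN (derM (derX k.+1 (is_derive_sin x)) (derive_theta_sph hC1 x c1)).
  rewrite [X in is_derive _ _ _ X](_ : _ = - (sin x ^+ k.+1 *
    (- sin x * sph_int (fun eta => 1 * dh 0 (spherical x eta)) + 
     cos x * sph_int (fun eta => 1 * radial dh x eta)) +
     k.+1%:R * sin x ^+ k * cos x * sph_int (fun eta => 1 * h (spherical x eta)))).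
    exact: D.
  rewrite !(radonZ r); [|by side..].
  set A := sph_int (fun eta => dh 0 (spherical x eta)).
  set B := sph_int (radial dh x).
  set C := sph_int (fun eta => h (spherical x eta)).
  rewrite (_ : sph_int _ = sin x ^+ 2 * A - (sin x * cos x) * B - (k.+1%:R * cos x) * C).
    by rewrite (exprS _ k); ring.
  rewrite -!(radonZ r); [|by side..].
  rewrite -(radonB r); [|by side..].
  rewrite -(radonB r); [|by side..].
  congr sph_int; apply/funext => eta.
  rewrite (_ : sin x ^+ 2 = 1 - cos x ^+ 2); last by rewrite sc; ring.
  by ring.
(* The flux through the latitude sphere of the meridian part of basis vector [lift 0 l]. Its part
   tangent to the latitude sphere is handled by the induction hypothesis. *)
pose f th := sin th ^+ k * cos th * sph_int (fun eta => eta 0 l * h (spherical th eta)).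
have cf : continuous f.
  rewrite /f; ctn; apply: (radon_continuous r (f := fun th eta => eta 0 l * h (spherical th eta))).
  by ctn; move=> p; exact: cvg_snd.
have pole (x : R) : sin x = 0 -> f x = 0 by exact: sph_int_pole.
suff df (x : R) : 0 < x < pi -> is_derive x 1 f (G x).
  by rewrite (FTC (pi_ge0 R) cf cQ df) !pole ?sinpi ?sin0 ?subrr.
move=> /andP[x0 xpi]; rewrite /G.
have s0 : sin x != 0 by apply/lt0r_neq0/sin_gt0_pi/andP.
have ca : continuous (fun eta : 'rV[R]_k.+1 => eta 0 l) by ctn.
have D := derM (derM (derX k (is_derive_sin x)) (is_derive_cos x))
  (derive_theta_sph hC1 x ca).
under eq_fun do rewrite sumE sphericalS.
apply: (is_derive_eq D).
have := IH _ _ l (C1_slice hC1 x).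
set A := sph_int (fun eta => dh (lift 0 l) (spherical x eta)).
set B := sph_int (fun eta => eta 0 l * radial dh x eta).
set C := sph_int (fun eta => eta 0 l * dh 0 (spherical x eta)).
set H := sph_int (fun eta => eta 0 l * h (spherical x eta)).
rewrite [X in X = 0 -> _](_ : _ = sin x * A - sin x * B - k%:R * H); last first.
  rewrite -!(radonZ r); [|by side..].
  rewrite -(radonB r); [|by side..].
  rewrite -(radonB r); [|by side..].
  congr sph_int; apply/funext => eta; congr (_ - _ - _).
  rewrite [RHS]mulrCA; congr (_ * _); rewrite /radial mulr_sumr.
  by apply: eq_bigr => j _; rewrite mulrCA.
move=> E.
have {E}E : sin x * A = sin x * B + k%:R * H by move: E; lra.
rewrite [sph_int _](_ : _ = A - sin x * cos x * C - sin x ^+ 2 * B - k.+1%:R * sin x * H); last first.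
  rewrite -!(radonZ r); [|by side..].
  rewrite -(radonB r); [|by side..].
  rewrite -(radonB r); [|by side..].
  rewrite -(radonB r); [|by side..].
  by congr sph_int; apply/funext => eta; ring.
(* The induction hypothesis gives [A] only through [sin x * A]; the extra factor also turns
   [sin x ^+ k.-1] into a power valid for [k = 0]. *)
apply: (mulfI s0).
transitivity (sin x ^+ k * (sin x * (- sin x * C * cos x + cos x ^+ 2 * B)) +
   (- sin x ^+ 2 * sin x ^+ k + k%:R * sin x ^+ k.-1 * sin x * cos x ^+ 2) * H).
  by ring.
rewrite mulrn_expr_pred sc.
transitivity (sin x ^+ k * (sin x * A + sin x * (- sin x * cos x * C - sin x ^+ 2 * B - k.+1%:R * sin x * H))); last by ring.
by rewrite E; ring.
Qed.

End SphereDivergence.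

(** * Symmetry of second partial derivatives *)

Section Clairaut.
Context {R : realType}.
Notation mu := (@lebesgue_measure R).

Lemma der_line n (h : 'rV[R]_n -> R) dh (i : 'I_n) (y : 'rV[R]_n) (s : R) :
  (forall y, is_derive y (evec i) h (dh y)) ->
  is_derive s 1 (fun s => h (y + s *: evec i)) (dh (y + s *: evec i)).
Proof. by move=> dhP; apply: (is_derive_line h y (evec i) s _).1; exact: dhP. Qed.

Lemma der_shift {V W : normedModType R} (f : V -> W) (a x v : V) (df : W) :
  is_derive (x + a) v f df -> is_derive x v (fun x => f (x + a)) df.
Proof.
move=> /is_deriveP H; apply/is_deriveP; move: H.
by under eq_fun do rewrite addrAC.
Qed.

Lemma is_derive_uniq {V W : normedModType R} (f : V -> W) (x v : V) (a b : W) :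
  is_derive x v f a -> is_derive x v f b -> a = b.
Proof. by move=> [_ <-] [_ <-]. Qed.

(** The increment of [h] along [evec i] is the integral of [hi]. Differentiating it along [evec j]
    under the integral gives [E], and differentiating [E] in the length [s] identifies the two mixed
    derivatives. *)
Lemma mixed_derivatives n (h hi hj hij hji : 'rV[R]_n -> R) (i j : 'I_n) :
  (forall y, is_derive y (evec i) h (hi y)) -> (forall y, is_derive y (evec j) h (hj y)) ->
  (forall y, is_derive y (evec j) hi (hji y)) -> (forall y, is_derive y (evec i) hj (hij y)) ->
  continuous h -> continuous hi -> continuous hji -> continuous hj -> hij = hji.
Proof.
move=> dhi dhj dhji dhij ch chi chji chj; apply/funext => y.
have line (f : 'rV[R]_n -> R) (z : 'rV[R]_n) : continuous f ->
    continuous (fun s : R => f (z + s *: evec i)).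
  by move=> cf; apply: (ct_comp (g := f)) => //; ctn.
have line2 (f : 'rV[R]_n -> R) : continuous f ->
    continuous (fun q : 'rV[R]_n * R => f (q.1 + q.2 *: evec i)).
  by move=> cf; apply: (ct_comp (g := f)) => //; ctn.
have E (s : R) (z : 'rV[R]_n) : 0 <= s ->
    hj (z + s *: evec i) - hj z = \int[mu]_(x in `[0, s]%classic) hji (z + x *: evec i).
  move=> s0.
  have D1 : is_derive z (evec j) (fun z => h (z + s *: evec i) - h z)
      (hj (z + s *: evec i) - hj z).
    exact: derD (der_shift (dhj (z + s *: evec i))) (derN (dhj z)).
  apply: is_derive_uniq D1 _.
  rewrite (_ : (fun z => _) =
      (fun z => \int[mu]_(x in `[0, s]%classic) hi (z + x *: evec i))); last first.
    apply/funext => z'.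
    have df (x : R) : 0 < x < s ->
        is_derive x 1 (fun x => h (z' + x *: evec i)) (hi (z' + x *: evec i)).
      by move=> _; exact: der_line.
    by rewrite (FTC s0 (line h z' ch) (line hi z' chi) df) scale0r addr0.
  apply: (radon_derive_all (radon_itv 0 s) (f := fun z x => hi (z + x *: evec i))
    (f' := fun z x => hji (z + x *: evec i))); try exact: line2.
  by move=> z' x; exact: der_shift (dhji (z' + x *: evec i)).
(* With base point [y - evec i] the point [y] sits at [s = 1], inside the range where [E] holds and
   the primitive from 0 has a two-sided derivative. *)
pose z := y - evec i.
have zy : z + 1 *: evec i = y by rewrite scale1r subrK.
rewrite -zy.
have D1 : is_derive (1 : R) 1 (fun s => hj (z + s *: evec i)) (hij (z + 1 *: evec i)).
  exact: der_line.
apply: is_derive_uniq D1 _.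
have D2 := primitive_derive (f := fun x => hji (z + x *: evec i)) (@ltr01 R) (line hji z chji).
have {D2}D2 := derD D2 (der_cst (hj z) _ _).
rewrite addr0 in D2; apply: der_near D2; first exact: oner_neq0.
apply/nbhs_ballP; exists 1 => //= s.
rewrite /ball/= => s1; rewrite -E ?subrK//.
by move: s1; rewrite ltr_norml; lra.
Qed.

End Clairaut.

(** * Leibniz's rule with a moving upper limit, valid at t = 0 *)

Section OrientedIntegral.
Context {R : realType}.
Notation mu := (@lebesgue_measure R).

(* For [t > -1] this is the integral of [f] from [0] to [t] with orientation;
   starting at [-1] makes it two-sided differentiable at [t = 0]. *)
Definition int0 (t : R) (f : R -> R) : R :=
  \int[mu]_(x in `[-1, t]%classic) f x - \int[mu]_(x in `[-1, 0]%classic) f x.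

Lemma int0E (t : R) f : 0 <= t -> continuous f ->
  \int[mu]_(x in `[0, t]%classic) f x = int0 t f.
Proof. by move=> t0 cf; rewrite (Rintegral_split (lerN10 R) t0 cf). Qed.

(** The limit is moved first with the parameter already at [t + h], giving [h * G (t + h) (t + c)]
    by the mean value theorem; then the parameter is moved with the limit fixed at [t]. *)
Lemma leibniz_rule (G G' : R -> R -> R) (t : R) : 0 <= t ->
  (forall s x : R, is_derive s 1 (fun s => G s x) (G' s x)) ->
  continuous (fun q : R * R => G q.1 q.2) -> continuous (fun q : R * R => G' q.1 q.2) ->
  is_derive t 1 (fun t => int0 t (G t)) (G t t + int0 t (G' t)).
Proof.
move=> t0 dG cG cG'.
have Nt : -1 < t by apply: lt_le_trans t0; exact: ltrN10.
have cGs s : continuous (G s) by exact: ct_slice cG.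
have D (b : R) : is_derive t 1 (fun t => \int[mu]_(x in `[-1, b]%classic) G t x)
    (\int[mu]_(x in `[-1, b]%classic) G' t x).
  exact: (radon_derive_all (radon_itv (-1) b) (f := G) (f' := G')).
rewrite /int0 addrA.
suff D1 : is_derive t 1 (fun t => \int[mu]_(x in `[-1, t]%classic) G t x)
    (G t t + \int[mu]_(x in `[-1, t]%classic) G' t x) by exact: derD D1 (derN (D 0)).
have /is_deriveP Dt := D t.
apply/is_deriveP.
have near_t : \forall h \near (0 : R), exists2 c, `|c| <= `|h| &
    \int[mu]_(x in `[-1, t + h]%classic) G (t + h) x -
    \int[mu]_(x in `[-1, t]%classic) G (t + h) x = h * G (t + h) (t + c).
  apply/nbhs_ballP; exists (t + 1); first by rewrite /=; lra.
  move=> h; rewrite /ball/= sub0r normrN => ht.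
  have [|c ch E] := @MVT_abs R (fun s => \int[mu]_(x in `[-1, t + s]%classic) G (t + h) x)
    (fun s => G (t + h) (t + s)) h.
    move=> c ch; have tc : -1 < t + c.
      have : `|c| < t + 1 by exact: le_lt_trans ht.
      by rewrite ltr_norml; lra.
    have P := primitive_derive tc (cGs (t + h)).
    have dc : is_derive c 1 (fun s => t + s) 1.
      by rewrite -[X in is_derive _ _ _ X]add0r; exact: derD (der_cst _ _ _) (der_id c).
    by have := der_comp P dc; rewrite mul1r.
  by exists c => //; rewrite -E addr0.
have [c cP] : {c : R -> R | \forall h \near (0 : R), `|c h| <= `|h| /\
    \int[mu]_(x in `[-1, t + h]%classic) G (t + h) x -
    \int[mu]_(x in `[-1, t]%classic) G (t + h) x = h * G (t + h) (t + c h)}.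
  have /choice[c cP] (h : R) : exists c : R, (exists2 c, `|c| <= `|h| &
    \int[mu]_(x in `[-1, t + h]%classic) G (t + h) x -
    \int[mu]_(x in `[-1, t]%classic) G (t + h) x = h * G (t + h) (t + c)) ->
    `|c| <= `|h| /\
    \int[mu]_(x in `[-1, t + h]%classic) G (t + h) x -
    \int[mu]_(x in `[-1, t]%classic) G (t + h) x = h * G (t + h) (t + c).
    have [[c c1 c2]|nc] := pselect (exists2 c, `|c| <= `|h| &
      \int[mu]_(x in `[-1, t + h]%classic) G (t + h) x -
      \int[mu]_(x in `[-1, t]%classic) G (t + h) x = h * G (t + h) (t + c)).
      by exists c.
    (* Default where no mean value point exists; [near_t] excludes this for small [h]. *)
    by exists 0.
  by apply/cid; exists c; apply: filterS near_t => h; exact: cP.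
have cvc : c h @[h --> (0 : R)] --> (0 : R).
  apply/cvgr0Pnorm_lt => e e0; near=> h.
  have [ch _] : `|c h| <= `|h| /\ \int[mu]_(x in `[-1, t + h]%classic) G (t + h) x -
    \int[mu]_(x in `[-1, t]%classic) G (t + h) x = h * G (t + h) (t + c h) by near: h.
  apply: le_lt_trans ch _; near: h.
  by apply/nbhs_ballP; exists e => //= h; rewrite /ball/= sub0r normrN.
have cvt (e : R -> R) : e h @[h --> (0 : R)] --> (0 : R) -> t + e h @[h --> (0 : R)] --> t.
  by move=> ce; rewrite -[X in _ --> X]addr0; apply: cvgD => //; exact: cvg_cst.
have cvG : G (t + h) (t + c h) @[h --> (0 : R)^'] --> G t t.
  apply: cvg_within_filter.
  have cvp : (t + h, t + c h) @[h --> (0 : R)] --> (t, t).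
    by apply: (@cvg_pair _ _ _ _ (nbhs t) (nbhs t)); [exact: cvt cvg_id | exact: cvt].
  exact: (@cvg_comp _ _ _ (fun h => (t + h, t + c h))
    (fun q : R * R => G q.1 q.2) _ (nbhs (t, t)) _ cvp (cG (t, t))).
have C := cvgD cvG Dt.
pose q (h : R) := h^-1 *: (\int[mu]_(x in `[-1, t + h *: 1]%classic) G (t + h *: 1) x -
             \int[mu]_(x in `[-1, t]%classic) G t x).
pose q' (h : R) := G (t + h) (t + c h) +
    h^-1 *: (\int[mu]_(x in `[-1, t]%classic) G (t + h *: 1) x -
             \int[mu]_(x in `[-1, t]%classic) G t x).
have EQ : {near (0 : R)^', q' =1 q}.
  apply: filterS2 (nbhs_dnbhs_neq _) (nbhs_dnbhs cP) => h h0 [_ E].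
  rewrite /q /q' -[h *: 1]/(h * 1) mulr1 -![_ *: _]/(_ * _).
  rewrite (_ : G (t + h) (t + c h) = h^-1 * (h * G (t + h) (t + c h))); last by rewrite mulKf.
  by rewrite -E -mulrDr addrA subrK.
by apply: (cvg_trans (near_eq_cvg EQ)); exact: C.
Unshelve. all: by end_near. Qed.

End OrientedIntegral.

Record C1_family (R : realType) k (Phi : R -> 'rV[R]_k.+1 -> R)
    (dPhi : 'I_k.+1 -> R -> 'rV[R]_k.+1 -> R) : Prop := {
  fam_der : forall i s y, is_derive y (evec i) (Phi s) (dPhi i s y);
  fam_ct : continuous (fun q : R * 'rV[R]_k.+1 => Phi q.1 q.2);
  fam_dct : forall i, continuous (fun q : R * 'rV[R]_k.+1 => dPhi i q.1 q.2) }.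
Arguments fam_der {R k Phi dPhi}.
Arguments fam_ct {R k Phi dPhi}.
Arguments fam_dct {R k Phi dPhi}.

(** * Spherical means, their derivatives and Darboux's equation *)

Section SphericalMeans.
Context {R : realType} {k : nat}.
Notation E := 'rV[R]_k.+1.
Notation S := (@sph_int R k).

Lemma C1_family_cst (f : E -> R) df : C1 f df -> C1_family (fun _ : R => f) (fun i _ => df i).
Proof.
move=> H; split.
- by move=> i _ y; exact: C1_der H i y.
- by apply: (ct_comp (g := f)); [exact: C1_ct H|move=> p; exact: cvg_snd].
- by move=> i; apply: (ct_comp (g := df i)); [exact: C1_dct H i|move=> p; exact: cvg_snd].
Qed.

(* Weighted spherical means; the weights are monomials in the components of
   the normal, produced by differentiating in [r]. *)
Definition smean (a : E -> R) (Phi : R -> E -> R) (r s : R) (x : E) : R :=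
  S (fun w => a w * Phi s (x + r *: w)).

Lemma ct_smean (P : topologicalType) (a : E -> R) (Phi : R -> E -> R) (r s : P -> R) (x : P -> E) :
  continuous a -> continuous (fun q : R * E => Phi q.1 q.2) ->
  continuous r -> continuous s -> continuous x ->
  continuous (fun p => smean a Phi (r p) (s p) (x p)).
Proof.
move=> ca cPhi cr cs cx.
apply: (radon_continuous (radon_sph k) (f := fun p w => a w * Phi (s p) (x p + r p *: w))).
by ctn.
Qed.

Lemma ct_sphere_point (Phi : R -> E -> R) (r s : R) (x : E) :
  continuous (fun q : R * E => Phi q.1 q.2) -> continuous (fun w : E => Phi s (x + r *: w)).
Proof.
by move=> cPhi; ctn.
Qed.

Lemma ct_sphere_point2 (Phi : R -> E -> R) (s : R) (x : E) :
  continuous (fun q : R * E => Phi q.1 q.2) ->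
  continuous (fun q : R * E => Phi s (x + q.1 *: q.2)).
Proof.
by move=> cPhi; ctn.
Qed.

Lemma ct_weight (a : E -> R) i : continuous a -> continuous (fun w : E => a w * w 0 i).
Proof. by move=> ca; ctn. Qed.

Lemma der_smean_r (a : E -> R) Phi dPhi (r s : R) (x : E) :
  continuous a -> C1_family Phi dPhi ->
  is_derive r 1 (fun r => smean a Phi r s x)
    (\sum_i smean (fun w => a w * w 0 i) (dPhi i) r s x).
Proof.
move=> ca H.
rewrite /smean -(radon_sum (radon_sph k)); last first.
  move=> i; apply: ctM; first exact: ct_weight.
  exact: ct_sphere_point (fam_dct H i).
have ca2 : continuous (fun q : R * E => a q.2).
  by apply: (ct_comp (g := a)) => // q; exact: cvg_snd.
apply: (radon_derive_all (radon_sph k) (f := fun (r : R) (w : E) => a w * Phi s (x + r *: w))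
  (f' := fun (r : R) (w : E) => \sum_i a w * w 0 i * dPhi i s (x + r *: w))).
- move=> u w.
  rewrite [X in is_derive _ _ _ X](_ : _ = a w * \sum_i w 0 i * dPhi i s (x + u *: w)); last first.
    by rewrite mulr_sumr; apply: eq_bigr => i _; rewrite mulrA.
  apply: derZ.
  apply: (chain_rule (h := Phi s) (dh := fun i => dPhi i s) (c := fun u => x + u *: w)
    (c' := fun i => w 0 i)).
  + by move=> i y; exact: fam_der H i s y.
  + by move=> i; exact: ct_slice (fam_dct H i).
  + move=> i; rewrite (_ : (fun u => _) = (fun u => x 0 i + u * w 0 i)); last first.
      by apply/funext => v; rewrite !mxE.
    have D := derD (der_cst (x 0 i) u 1) (derM (der_id u) (der_cst (w 0 i) _ _)).
    by apply: (is_derive_eq D); ring.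
- by apply: ctM => //; exact: ct_sphere_point2 (fam_ct H).
- apply: ct_sum => i; apply: ctM; last exact: ct_sphere_point2 (fam_dct H i).
  by ctn.
Qed.

Lemma der_smean_x (a : E -> R) Phi dPhi (i : 'I_k.+1) (r s : R) (x : E) :
  continuous a -> C1_family Phi dPhi ->
  is_derive x (evec i) (smean a Phi r s) (smean a (dPhi i) r s x).
Proof.
move=> ca H.
have ca2 : continuous (fun q : E * E => a q.2).
  by apply: (ct_comp (g := a)) => // q; exact: cvg_snd.
have ct2 (Psi : R -> E -> R) : continuous (fun q : R * E => Psi q.1 q.2) ->
    continuous (fun q : E * E => Psi s (q.1 + r *: q.2)).
  by move=> cPsi; ctn.
apply: (radon_derive_all (radon_sph k) (f := fun x w => a w * Phi s (x + r *: w))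
  (f' := fun x w => a w * dPhi i s (x + r *: w))).
- by move=> y w; apply: derZ; exact: der_shift (fam_der H i s _).
- by apply: ctM => //; exact: ct2 (fam_ct H).
- by apply: ctM => //; exact: ct2 (fam_dct H i).
Qed.

Lemma smean_sum (I : Type) (l : seq I) (a : E -> R) (Phi : I -> R -> E -> R) (r s : R) (x : E) :
  continuous a -> (forall i, continuous (fun q : R * E => Phi i q.1 q.2)) ->
  smean a (fun s y => \sum_(i <- l) Phi i s y) r s x = \sum_(i <- l) smean a (Phi i) r s x.
Proof.
move=> ca cPhi; rewrite /smean -(radon_sum (radon_sph k)).
  by congr S; apply/funext => w; rewrite mulr_sumr.
by move=> i; apply: ctM => //; exact: ct_sphere_point (cPhi i).
Qed.

(** The divergence theorem for [w] sent to [Phi s (x + r *: w)], whose gradient carries the factor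
    [r]. *)
Lemma smean_divergence Phi dPhi (i : 'I_k.+1) (r s : R) (x : E) :
  C1_family Phi dPhi ->
  r * smean (fun=> 1) (dPhi i) r s x =
  r * \sum_j smean (fun w => 1 * w 0 i * w 0 j) (dPhi j) r s x +
  k%:R * smean (fun w => 1 * w 0 i) Phi r s x.
Proof.
move=> H.
have HC1 : C1 (fun w => Phi s (x + r *: w)) (fun j w => r * dPhi j s (x + r *: w)).
  split.
  - move=> j y; rewrite -{1}[y]addr0 -(scale0r (evec j)).
    apply: (is_derive_line (fun w => Phi s (x + r *: w)) y (evec j) 0 _).2.
    have cdPhi l : continuous (dPhi l s) by exact: ct_slice (fam_dct H l).
    have := @chain_rule R _ (Phi s) (fun i => dPhi i s) (fun u => x + r *: (y + u *: evec j))
      (fun i => r * (i == j)%:R) 0 (fun i y => fam_der H i s y) cdPhi.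
    rewrite scale0r addr0 (bigD1 j)//= eqxx mulr1 big1 ?addr0; last first.
      by move=> l lj; rewrite (negbTE lj) mulr0 mul0r.
    apply => l; rewrite (_ : (fun u => _) =
      (fun u => (x 0 l + r * y 0 l) + u * (r * (l == j)%:R))); last first.
      by apply/funext => v; rewrite !mxE /=; ring.
    have D := derD (der_cst (x 0 l + r * y 0 l) (0 : R) 1)
      (derM (der_id (0 : R)) (der_cst (r * (l == j)%:R) _ _)).
    by apply: (is_derive_eq D); ring.
  - exact: ct_sphere_point (fam_ct H).
  - by move=> j; apply: ctM; [exact: ct_cst | exact: ct_sphere_point (fam_dct H j)].
have r_sph := @radon_sph R k.
have cd j : continuous (fun w : E => dPhi j s (x + r *: w)) by exact: ct_sphere_point (fam_dct H j).
have := sphere_divergence i HC1.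
rewrite (radonZ r_sph)// => D.
rewrite /smean.
under eq_fun do rewrite mul1r.
rewrite D; congr (_ + _ * S _); last by apply/funext => w; rewrite mul1r.
rewrite -(radon_sum r_sph); last by move=> j; ctn; exact: cd.
rewrite -(radonZ r_sph); last by ctn; exact: cd.
congr S; apply/funext => w; rewrite !mulr_sumr; apply: eq_bigr => j _; ring.
Qed.

(* [r m'' + k m' = r m(Delta Phi)], with [m''] and [m'] in expanded form. *)
Lemma darboux Phi dPhi ddPhi (r s : R) (x : E) :
  C1_family Phi dPhi -> (forall i, C1_family (dPhi i) (ddPhi^~ i)) ->
  r * (\sum_i \sum_j smean (fun w => 1 * w 0 i * w 0 j) (ddPhi j i) r s x) +
  k%:R * \sum_i smean (fun w => 1 * w 0 i) (dPhi i) r s x =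
  r * \sum_i smean (fun=> 1) (ddPhi i i) r s x.
Proof.
move=> H1 H2; rewrite !mulr_sumr -big_split /=; apply: eq_bigr => i _.
by rewrite (smean_divergence i r s x (H2 i)).
Qed.

Lemma smean_at0 Phi (s : R) (x : E) : smean (fun=> 1) Phi 0 s x = omega k.+1 * Phi s x.
Proof.
rewrite /smean /omega /= -(radonZr (radon_sph k)); last exact: ct_cst.
by congr S; apply/funext => w; rewrite scale0r addr0.
Qed.

End SphericalMeans.

Section RadialDerivatives.
Context {R : realType} {k : nat}.
Notation E := 'rV[R]_k.+1.
Notation S := (@sph_int R k).

(** [mean1] and [mean2] are the radial derivatives of the unnormalised mean [mean0]. Their factors
    [1 *] are what [der_smean_r] yields from the constant weight. *)
Definition mean0 (Phi : R -> E -> R) r s x := smean (fun=> 1) Phi r s x.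
Definition mean1 (dPhi : 'I_k.+1 -> R -> E -> R) r s x :=
  \sum_i smean (fun w => 1 * w 0 i) (dPhi i) r s x.
Definition mean2 (ddPhi : 'I_k.+1 -> 'I_k.+1 -> R -> E -> R) r s x :=
  \sum_i \sum_j smean (fun w => 1 * w 0 i * w 0 j) (ddPhi j i) r s x.

Lemma ct_one : continuous (fun _ : E => 1 : R).
Proof. exact: ct_cst. Qed.

Lemma ct_normal i : continuous (fun w : E => 1 * w 0 i : R).
Proof. by ctn. Qed.

Section Families.
Variables (Phi : R -> E -> R) (dPhi : 'I_k.+1 -> R -> E -> R).
Variable ddPhi : 'I_k.+1 -> 'I_k.+1 -> R -> E -> R.
Hypothesis H1 : C1_family Phi dPhi.
Hypothesis H2 : forall i, C1_family (dPhi i) (ddPhi^~ i).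

Lemma der_mean0 (r s : R) (x : E) :
  is_derive r 1 (fun r => mean0 Phi r s x) (mean1 dPhi r s x).
Proof. exact: (der_smean_r r s x ct_one H1). Qed.

Lemma der_mean1 (r s : R) (x : E) :
  is_derive r 1 (fun r => mean1 dPhi r s x) (mean2 ddPhi r s x).
Proof. by rewrite /mean1 /mean2; apply: der_sum => i; exact: (der_smean_r r s x (@ct_normal i) (H2 i)). Qed.

Lemma der_mean0_x i (r s : R) (x : E) :
  is_derive x (evec i) (mean0 Phi r s) (mean0 (dPhi i) r s x).
Proof. exact: (der_smean_x i r s x ct_one H1). Qed.

Lemma der_mean1_x i (r s : R) (x : E) :
  is_derive x (evec i) (mean1 dPhi r s) (mean1 (ddPhi i) r s x).
Proof.
by rewrite /mean1; apply: der_sum => j; exact: (der_smean_x i r s x (@ct_normal j) (H2 j)).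
Qed.

Lemma darboux_mean (r s : R) (x : E) :
  r * mean2 ddPhi r s x + k%:R * mean1 dPhi r s x = r * \sum_i mean0 (ddPhi i i) r s x.
Proof. exact: (darboux r s x H1 H2). Qed.

Lemma mean0_at0 (s : R) (x : E) : mean0 Phi 0 s x = omega k.+1 * Phi s x.
Proof. exact: smean_at0. Qed.

Lemma mean0E (r s : R) (x : E) : S (fun w => Phi s (x + r *: w)) = mean0 Phi r s x.
Proof. by rewrite /mean0 /smean; congr S; apply/funext => w; rewrite mul1r. Qed.

Lemma mean1E (r s : R) (x : E) :
  S (fun w => \sum_i w 0 i * dPhi i s (x + r *: w)) = mean1 dPhi r s x.
Proof.
rewrite /mean1 /smean -(radon_sum (radon_sph k)).
  by congr S; apply/funext => w; apply: eq_bigr => i _; rewrite mul1r.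
move=> i; apply: ctM; first exact: ct_normal.
exact: ct_sphere_point (fam_dct H1 i).
Qed.

End Families.

Lemma Ck_continuous n m (f : 'rV[R]_n -> R) : Ck m f -> continuous f.
Proof. by case: m => [|m] // []. Qed.

Lemma Ck_C1 n m (f : 'rV[R]_n -> R) : Ck m.+1 f -> C1 f (fun i => pderiv i f).
Proof.
move=> [cf [df H]]; split => //; last by move=> i; exact: Ck_continuous (H i).
Qed.

Lemma Ck_pderiv n m (f : 'rV[R]_n -> R) i : Ck m.+1 f -> Ck m (pderiv i f).
Proof. by move=> [_ [_]]; exact. Qed.

Lemma Ck_pred n m (f : 'rV[R]_n -> R) : Ck m.+1 f -> Ck m f.
Proof.
elim: m f => [|m IH] f; first by move=> [].
by move=> [cf [df H]]; split => //; split => // i; exact: IH (H i).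
Qed.

Lemma pderivC n (f : 'rV[R]_n -> R) i j : Ck 2 f ->
  pderiv i (pderiv j f) = pderiv j (pderiv i f).
Proof.
move=> f2; have f1 := Ck_C1 f2.
have fi l := Ck_C1 (Ck_pderiv l f2).
apply: (@mixed_derivatives R n f (pderiv i f) (pderiv j f) _ _ i j).
- exact: C1_der f1 i.
- exact: C1_der f1 j.
- exact: C1_der (fi i) j.
- exact: C1_der (fi j) i.
- exact: C1_ct f1.
- exact: C1_dct f1 i.
- exact: C1_dct (fi i) j.
- exact: C1_dct f1 j.
Qed.

Lemma pderivC_lap n (f : 'rV[R]_n -> R) i l : Ck 3 f ->
  pderiv i (pderiv i (pderiv l f)) = pderiv l (pderiv i (pderiv i f)).
Proof.
move=> f3; rewrite (pderivC i l (Ck_pred f3)).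
by rewrite (pderivC i l (Ck_pderiv i f3)).
Qed.

Lemma sum_combination n (a b t : R) (A B C : 'I_n -> R) :
  \sum_i a * (b * (t * A i) + B i + t * C i) =
  a * (b * (t * \sum_i A i) + \sum_i B i + t * \sum_i C i).
Proof. by rewrite -mulr_sumr !big_split /= -!mulr_sumr. Qed.

Lemma C1_family_lap m (f : E -> R) : Ck m.+3 f ->
  C1_family (fun _ : R => lap f) (fun l _ y => \sum_i pderiv l (pderiv i (pderiv i f)) y).
Proof.
move=> f3.
have fii i := Ck_C1 (Ck_pderiv i (Ck_pderiv i f3)).
apply: (@C1_family_cst _ _ (lap f) (fun l y => \sum_i pderiv l (pderiv i (pderiv i f)) y)).
split.
- by move=> l y; apply: der_sum => i; exact: C1_der (fii i) l y.
- by apply: ct_sum => i; exact: C1_ct (fii i).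
- by move=> l; apply: ct_sum => i; exact: C1_dct (fii i) l.
Qed.

Lemma omega_neq0 : omega k.+1 != 0 :> R.
Proof. exact: lt0r_neq0 (sph_int1_gt0 k). Qed.

End RadialDerivatives.
Arguments ct_normal {R k}.
Arguments ct_one {R k}.

(** * The free part V: derivatives, wave equation and initial values *)

Section Homogeneous.
Context {R : realType} {k : nat}.
Notation E := 'rV[R]_k.+1.
Variables (f g : E -> R).
Hypotheses (k2 : (2 <= k)%N) (f3 : Ck 3 f) (g2 : Ck 2 g).

Let fam (h : E -> R) := fun _ : R => h.
Let d (h : E -> R) := fun (i : 'I_k.+1) (_ : R) => pderiv i h.
Let dd (h : E -> R) := fun (j i : 'I_k.+1) (_ : R) => pderiv j (pderiv i h).
Let dlap := fun l (_ : R) y => \sum_i pderiv l (pderiv i (pderiv i f)) y.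
Let alpha : R := (k.+1%:R - 2)^-1.

Let Hf : C1_family (fam f) (d f) := C1_family_cst (Ck_C1 f3).
Let Hg : C1_family (fam g) (d g) := C1_family_cst (Ck_C1 g2).
Let Hdf i : C1_family (d f i) ((dd f)^~ i) := C1_family_cst (Ck_C1 (Ck_pderiv i f3)).
Let Hdg i : C1_family (d g i) ((dd g)^~ i) := C1_family_cst (Ck_C1 (Ck_pderiv i g2)).
Let Hddf i j : C1_family (dd f j i) (fun l _ => pderiv l (pderiv j (pderiv i f))) :=
  C1_family_cst (Ck_C1 (Ck_pderiv j (Ck_pderiv i f3))).
Let Hlap : C1_family (fam (lap f)) dlap := C1_family_lap f3.

Lemma dim_sub2 : k.+1%:R - 2 = k%:R - 1 :> R.
Proof. by rewrite -natr1; ring. Qed.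

Lemma dim_sub2_neq0 : k.+1%:R - 2 != 0 :> R.
Proof. by rewrite dim_sub2 subr_eq0 (eqr_nat R k 1) gtn_eqF. Qed.

Definition V0 (x : E) (t : R) : R := (omega k.+1)^-1 *
  (alpha * (t * mean1 (d f) t 0 x) + mean0 (fam f) t 0 x + t * mean0 (fam g) t 0 x).
(** Stated after Darboux's equation has removed [mean2] of [f], so that the radial derivative of the
    mean of [lap f] appears alike in [Vtt] and in the sum of the [Vxx]. *)
Definition Vt (x : E) (t : R) : R := (omega k.+1)^-1 *
  (alpha * (t * mean0 (fam (lap f)) t 0 x) + mean0 (fam g) t 0 x + t * mean1 (d g) t 0 x).
Definition Vtt (x : E) (t : R) : R := (omega k.+1)^-1 *
  (alpha * (mean0 (fam (lap f)) t 0 x + t * mean1 dlap t 0 x) + 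
   mean1 (d g) t 0 x + (mean1 (d g) t 0 x + t * mean2 (dd g) t 0 x)).
Definition Vx i (x : E) (t : R) : R := (omega k.+1)^-1 *
  (alpha * (t * mean1 (dd f i) t 0 x) + mean0 (d f i) t 0 x + t * mean0 (d g i) t 0 x).
Definition Vxx i (x : E) (t : R) : R := (omega k.+1)^-1 *
  (alpha * (t * mean1 (fun j _ => pderiv i (pderiv i (pderiv j f))) t 0 x) +
   mean0 (dd f i i) t 0 x + t * mean0 (dd g i i) t 0 x).

Lemma VfunE x t : Vfun f g x t = V0 x t.
Proof.
rewrite /Vfun /V0; congr (_ * _).
have cf : continuous (fun w : E => f (x + t *: w)).
  exact: (@ct_sphere_point _ _ (fam f) t 0 x (fam_ct Hf)).
have cg : continuous (fun w : E => g (x + t *: w)).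
  exact: (@ct_sphere_point _ _ (fam g) t 0 x (fam_ct Hg)).
have cw : continuous (fun w : E => \sum_i w 0 i * d f i 0 (x + t *: w)).
  by apply: ct_sum => i; apply: ctM; [ctn | exact: ct_sphere_point (fam_dct Hf i)].
rewrite -(mean1E Hf) -(mean0E (fam f)) -(mean0E (fam g)).
have r := radon_sph (R := R) k.
rewrite -(radonZ r t cw) -(radonZ r t cg).
rewrite -(radonZ r); last by ctn.
rewrite -(radonD r); [|by ctn..].
rewrite -(radonD r); [|by ctn..].
rewrite /= /wgrad; congr sph_int; apply/funext => w.
by rewrite -/alpha mulrC.
Qed.

Lemma mean0_lap (t : R) (x : E) :
  \sum_i mean0 (dd f i i) t 0 x = mean0 (fam (lap f)) t 0 x.
Proof.
rewrite /mean0 -(smean_sum _ _ _ _ ct_one)//.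
by move=> i; exact: fam_ct (Hddf i i).
Qed.

Lemma der_V0 x (t : R) : is_derive t 1 (V0 x) (Vt x t).
Proof.
have D := derZ (omega k.+1)^-1 (derD (derD (derZ alpha (derM (der_id t) (der_mean1 Hdf t 0 x)))
  (der_mean0 Hf t 0 x)) (derM (der_id t) (der_mean0 Hg t 0 x))).
apply: (is_derive_eq D); rewrite /Vt; congr (_ * _).
have := darboux_mean Hf Hdf t 0 x; rewrite mean0_lap => A.
have {A}-> : t * mean2 (dd f) t 0 x = t * mean0 (fam (lap f)) t 0 x - k%:R * mean1 (d f) t 0 x.
  by rewrite -A addrK.
(* With n = k + 1, the coefficients of [mean1 (d f)] add up to 1 - k + (n - 2) = 0 after
   multiplication by n - 2. *)
rewrite (_ : k%:R = (k.+1%:R - 2) + 1 :> R); last by rewrite dim_sub2 subrK.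
have := dim_sub2_neq0; rewrite /alpha; set a := k.+1%:R - 2 => a0.
by field.
Qed.

Lemma der_Vt x (t : R) : is_derive t 1 (Vt x) (Vtt x t).
Proof.
have D := derZ (omega k.+1)^-1 (derD (derD (derZ alpha (derM (der_id t) (der_mean0 Hlap t 0 x)))
  (der_mean0 Hg t 0 x)) (derM (der_id t) (der_mean1 Hdg t 0 x))).
by apply: (is_derive_eq D); rewrite /Vtt; congr (_ * _); ring.
Qed.

Lemma der_Vx i (t : R) (x : E) : is_derive x (evec i) (V0^~ t) (Vx i x t).
Proof.
by have := derZ (omega k.+1)^-1 (derD (derD (derZ alpha (derZ t (der_mean1_x Hdf i t 0 x)))
  (der_mean0_x Hf i t 0 x)) (derZ t (der_mean0_x Hg i t 0 x))).
Qed.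

Lemma der_Vxx i (t : R) (x : E) : is_derive x (evec i) (Vx i ^~ t) (Vxx i x t).
Proof.
have H j : C1_family (dd f i j) (fun l _ => pderiv l (pderiv i (pderiv j f))) := Hddf j i.
by have := derZ (omega k.+1)^-1 (derD (derD (derZ alpha (derZ t (der_mean1_x
  (ddPhi := fun l j _ => pderiv l (pderiv i (pderiv j f))) H i t 0 x)))
  (der_mean0_x (Hdf i) i t 0 x)) (derZ t (der_mean0_x (Hdg i) i t 0 x))).
Qed.

(** The third derivatives of [f] cancel. What is left has coefficient 1 / (n - 2) - 1 = - (n - 3) /
    (n - 2) on the mean of [lap f], and 2 - (n - 1) = - (n - 3) on [mean1 (d g)], by Darboux's
    equation for [g]. *)
Lemma V_wave (x : E) (t : R) : Vtt x t - \sum_i Vxx i x t =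
  - ((k.+1%:R - 3) / ((k.+1%:R - 2) * omega k.+1) *
     sphere_int (fun w : E => lap f (x + t *: w) + (k.+1%:R - 2) * wgrad g w (x + t *: w))).
Proof.
have -> : sphere_int (fun w : E => lap f (x + t *: w) + (k.+1%:R - 2) * wgrad g w (x + t *: w)) =
    mean0 (fam (lap f)) t 0 x + (k.+1%:R - 2) * mean1 (d g) t 0 x.
  have cl : continuous (fun w : E => lap f (x + t *: w)).
    exact: (@ct_sphere_point _ _ (fam (lap f)) t 0 x (fam_ct Hlap)).
  have cw : continuous (fun w : E => \sum_i w 0 i * d g i 0 (x + t *: w)).
    by apply: ct_sum => i; apply: ctM; [ctn | exact: ct_sphere_point (fam_dct Hg i)].
  have r := radon_sph (R := R) k.
  rewrite -(mean1E Hg) -(mean0E (fam (lap f))) -(radonZ r _ cw) -(radonD r)//.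
  by ctn.
have -> : \sum_i Vxx i x t = (omega k.+1)^-1 * (alpha * (t * mean1 dlap t 0 x) +
    mean0 (fam (lap f)) t 0 x + t * \sum_i mean0 (dd g i i) t 0 x).
  rewrite -(mean0_lap t x).
  transitivity ((omega k.+1)^-1 * (alpha * (t * \sum_i mean1
    (fun j _ => pderiv i (pderiv i (pderiv j f))) t 0 x) +
    \sum_i mean0 (dd f i i) t 0 x + t * \sum_i mean0 (dd g i i) t 0 x)).
    exact: sum_combination.
  congr (_ * (_ * (_ * _) + _ + _)).
  (* Differentiating in x puts the normal index [l] innermost, differentiating the mean of [lap f]
     in r puts it outermost; [pderivC_lap] reconciles them. *)
  rewrite /mean1 exchange_big /=; apply: eq_bigr => l _.
  rewrite -(smean_sum _ _ _ _ (ct_normal l)); last first.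
    by move=> i; rewrite (pderivC_lap i l f3); exact: fam_dct (Hddf i i) l.
  suff -> : dlap l = fun _ y => \sum_i pderiv i (pderiv i (pderiv l f)) y by [].
  apply/funext => s; apply/funext => y; rewrite /dlap; apply: eq_bigr => i _.
  by rewrite (pderivC_lap i l f3).
have A := darboux_mean Hg Hdg t 0 x.
rewrite /Vtt -A (_ : k%:R = (k.+1%:R - 2) + 1 :> R); last by rewrite dim_sub2 subrK.
have := dim_sub2_neq0; rewrite /alpha (_ : k.+1%:R - 3 = (k.+1%:R - 2) - 1 :> R); last by ring.
set a := k.+1%:R - 2 => a0.
have w0 : omega k.+1 != 0 :> R := omega_neq0.
by field; rewrite w0 a0.
Qed.

Lemma V_at0 x : V0 x 0 = f x.
Proof.
by rewrite /V0 !mul0r mulr0 add0r addr0 mean0_at0 mulKf// omega_neq0.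
Qed.

Lemma Vt_at0 x : Vt x 0 = g x.
Proof.
by rewrite /Vt !mul0r mulr0 add0r addr0 mean0_at0 mulKf// omega_neq0.
Qed.

End Homogeneous.

(** * One-sided time derivatives and the extension of the source to negative times *)

Section TimeDerivative.
Context {R : realType}.

Lemma tfilter_pos (t : R) : 0 < t -> tfilter t = (0 : R)^'.
Proof.
move=> t0; apply/funext => P; apply/propext.
rewrite -[tfilter t P]/(\forall h \near (0 : R), h != 0 /\ 0 <= t + h -> P h).
rewrite -[(0 : R)^' P]/(\forall h \near (0 : R), h != 0 -> P h).
split => H; last by apply: filterS H => h H [h0 _]; exact: H.
have N : \forall h \near (0 : R), 0 <= t + h.
  apply/nbhs_ballP; exists t => //= h; rewrite /ball/= sub0r normrN => /ltr_normlP[]; lra.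
by apply: filterS2 N H => h th H h0; exact: H.
Qed.

(** Reduces the one-sided derivative at 0 to a two-sided one of any continuation [J]. *)
Lemma has_tderivW (phi J : R -> R) (t l : R) : 0 <= t ->
  (forall s, 0 <= s -> phi s = J s) -> is_derive t 1 J l -> has_tderiv phi t l.
Proof.
move=> t0 E /is_deriveP D; rewrite /has_tderiv => P /D.
rewrite /nbhs /= /dnbhs /tfilter /within /=; apply: filterS => h H [h0 th].
have := H h0; rewrite -[h *: 1]/(h * 1) mulr1 /= !E//.
Qed.

Lemma is_derive_tderiv (phi : R -> R) (t : R) : 0 < t ->
  (exists l, has_tderiv phi t l) ->
  is_derive t 1 (fun s => phi (Num.max 0 s)) (tderiv phi t).
Proof.
move=> t0 [l Hl].
have D : is_derive t 1 phi (tderiv phi t).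
  apply/is_deriveP; rewrite /tderiv tfilter_pos//.
  have : cvg ((fun h => h^-1 * (phi (t + h) - phi t)) @ (0 : R)^').
    by apply/cvg_ex; exists l; rewrite -(tfilter_pos t0).
  apply: cvg_trans; apply: near_eq_cvg; near=> h.
  by rewrite -[h *: 1]/(h * 1) mulr1.
apply: der_near D; first exact: oner_neq0.
apply/nbhs_ballP; exists t => //= s; rewrite /ball/= => /ltr_normlP[ts1 ts2].
by rewrite max_r//; lra.
Unshelve. all: by end_near. Qed.

End TimeDerivative.

Section Extension.
Context {R : realType} {k : nat}.
Notation E := 'rV[R]_k.+1.

(* Freezing the source at [t = 0] for negative times keeps it continuous, with
   continuous space derivatives, on the whole of [R * E]. *)
Definition ext (F : E -> R -> R) : R -> E -> R := fun s y => F y (Num.max 0 s).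

Lemma ct_ext (F : E -> R -> R) : hcont F -> continuous (fun q : R * E => ext F q.1 q.2).
Proof.
move=> /subspace_continuousP cF q.
pose phi (q : R * E) := (q.2, Num.max 0 q.1).
have cphi : continuous phi.
  apply: ct_pair; first by move=> p; exact: cvg_snd.
  rewrite (_ : (fun x => _) = (fun q : R * E => 2^-1 * (q.1 + `|q.1|))); last first.
    apply/funext => p; have [p0|p0] := leP 0 p.1.
      by rewrite ger0_norm//; field.
    by rewrite ltr0_norm//; field.
  ctn; move=> p; apply: cvg_norm; exact: cvg_fst.
have A p : 0 <= (phi p).2 by rewrite /= le_max lexx.
move=> P HP.
have H1 : nbhs (phi q) (fun p => 0 <= p.2 -> P (F p.1 p.2)) by exact: cF (A q) _ HP.
have H2 : nbhs q (fun p => 0 <= (phi p).2 -> P (F (phi p).1 (phi p).2)) by exact: cphi H1.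
by apply: filterS H2 => p; exact.
Qed.

Lemma HCk_hcont m (F : E -> R -> R) : HCk m F -> hcont F.
Proof. by case: m => [|m] // []. Qed.

Lemma ext_C1_family m (F : E -> R -> R) : HCk m.+1 F ->
  C1_family (ext F) (fun i => ext (fun x t => pderiv i (F ^~ t) x)).
Proof.
move=> [cF [dF [_ [HF _]]]]; split.
- move=> i s y; apply: (@DeriveDef _ _ _ _ _ (ext F s)); last by [].
  by apply: dF; rewrite le_max lexx.
- exact: ct_ext.
- by move=> i; exact: ct_ext (HCk_hcont (HF i)).
Qed.

End Extension.

(** * Duhamel's integral: derivatives and wave equation *)

Section Inhomogeneous.
Context {R : realType} {k : nat}.
Notation E := 'rV[R]_k.+1.
Notation mu := (@lebesgue_measure R).
Variable F : E -> R -> R.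
Hypotheses (k2 : (2 <= k)%N) (F2 : HCk 2 F).

Let Phi := ext F.
Let d i := ext (fun x t => pderiv i (F ^~ t) x).
Let dd j i := ext (fun x t => pderiv j (fun y => pderiv i (F ^~ t) y) x).
Let Phit := ext (fun x t => tderiv (F x) t).
Let c : R := ((k.+1%:R - 2) * omega k.+1)^-1.

Let H1 : C1_family Phi d := ext_C1_family F2.

Lemma source_C1_family i : C1_family (d i) (dd^~ i).
Proof. by have [_ [_ [_ [HF _]]]] := F2; apply: (@ext_C1_family _ _ 0); exact: HF i. Qed.
Let H2 := source_C1_family.

Lemma ct_source_t : continuous (fun q : R * E => Phit q.1 q.2).
Proof. by have [_ [_ [_ [_ HF]]]] := F2; exact: ct_ext (@HCk_hcont _ _ 1 _ HF). Qed.

Section Kernels.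
Variable x : E.
Context {T : topologicalType} (r s : T -> R).
Hypotheses (cr : continuous r) (cs : continuous s).

Lemma ct_mean0 (Psi : R -> E -> R) : continuous (fun q : R * E => Psi q.1 q.2) ->
  continuous (fun p => mean0 Psi (r p) (s p) x).
Proof.
by move=> cPsi; exact: (ct_smean (x := fun=> x) (ct_one) cPsi cr cs (ct_cst x)).
Qed.

Lemma ct_mean1 : continuous (fun p => mean1 d (r p) (s p) x).
Proof.
apply: ct_sum => i.
exact: (ct_smean (x := fun=> x) (ct_normal i) (fam_dct H1 i) cr cs (ct_cst x)).
Qed.

Lemma ct_mean2 : continuous (fun p => mean2 dd (r p) (s p) x).
Proof.
apply: ct_sum => i; apply: ct_sum => j.
apply: (ct_smean (x := fun=> x) _ (fam_dct (H2 i) j) cr cs (ct_cst x)).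
by ctn.
Qed.

End Kernels.

Definition G0 (x : E) (t s : R) := (t - s) * mean0 Phi (t - s) s x.
Definition G1 (x : E) (t s : R) := mean0 Phi (t - s) s x + (t - s) * mean1 d (t - s) s x.
Definition G2 (x : E) (t s : R) := 2 * mean1 d (t - s) s x + (t - s) * mean2 dd (t - s) s x.

Lemma ct_lag : continuous (fun q : R * R => q.1 - q.2).
Proof. by ctn. Qed.

Lemma ct_time : continuous (fun q : R * R => q.2).
Proof. by ctn. Qed.

Lemma ct_G0 x : continuous (fun q : R * R => G0 x q.1 q.2).
Proof. by apply: ctM; [exact: ct_lag | exact: (@ct_mean0 x _ _ _ ct_lag ct_time Phi (fam_ct H1))]. Qed.

Lemma ct_G1 x : continuous (fun q : R * R => G1 x q.1 q.2).
Proof.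
apply: ctD; first exact: (@ct_mean0 x _ _ _ ct_lag ct_time Phi (fam_ct H1)).
by apply: ctM; [exact: ct_lag | exact: ct_mean1 ct_lag ct_time].
Qed.

Lemma ct_G2 x : continuous (fun q : R * R => G2 x q.1 q.2).
Proof.
apply: ctD; first by apply: ctM; [exact: ct_cst | exact: ct_mean1 ct_lag ct_time].
by apply: ctM; [exact: ct_lag | exact: ct_mean2 ct_lag ct_time].
Qed.

Lemma der_lag (t s : R) : is_derive t 1 (fun t => t - s) 1.
Proof. by apply: (is_derive_eq (derD (der_id t) (der_cst (- s) _ _))); rewrite addr0. Qed.

Lemma der_G0 x (t s : R) : is_derive t 1 (fun t => G0 x t s) (G1 x t s).
Proof.
have D := derM (der_lag t s) (der_shift (der_mean0 H1 (t - s) s x)).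
by apply: (is_derive_eq D); rewrite /G1; ring.
Qed.

Lemma der_G1 x (t s : R) : is_derive t 1 (fun t => G1 x t s) (G2 x t s).
Proof.
have D := derD (der_shift (der_mean0 H1 (t - s) s x))
  (derM (der_lag t s) (der_shift (der_mean1 H2 (t - s) s x))).
by apply: (is_derive_eq D); rewrite /G2; ring.
Qed.

(** Time derivatives use the oriented integral, which agrees with [NF] for [t >= 0]; space
    derivatives keep [t] fixed and use the plain one. *)
Definition N0 (x : E) (t : R) := c * int0 t (G0 x t).
Definition Nt (x : E) (t : R) := c * int0 t (G1 x t).
Definition Ntt (x : E) (t : R) := c * (omega k.+1 * F x t + int0 t (G2 x t)).
Definition Nx i (x : E) (t : R) :=
  c * \int[mu]_(s in `[0, t]%classic) ((t - s) * mean0 (d i) (t - s) s x).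
Definition Nxx i (x : E) (t : R) :=
  c * \int[mu]_(s in `[0, t]%classic) ((t - s) * mean0 (dd i i) (t - s) s x).

Lemma NF_E x (t : R) : NF F x t = c * \int[mu]_(s in `[0, t]%classic) G0 x t s.
Proof.
rewrite /NF; congr (_ * _); apply: eq_Rintegral => s; rewrite inE /= in_itv/= => /andP[s0 _].
by rewrite /G0 -mean0E /Phi /ext max_r.
Qed.

Lemma NF_N0 x (t : R) : 0 <= t -> NF F x t = N0 x t.
Proof. by move=> t0; rewrite NF_E (int0E t0)//; exact: ct_slice (@ct_G0 x). Qed.

Lemma der_N0 x (t : R) : 0 <= t -> is_derive t 1 (N0 x) (Nt x t).
Proof.
move=> t0; have D := derZ c (leibniz_rule t0 (der_G0 x) (@ct_G0 x) (@ct_G1 x)).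
by apply: (is_derive_eq D); rewrite /Nt /G0 subrr mul0r add0r.
Qed.

(** The source emerges from the diagonal term of Leibniz's rule: [G1 x t t] is a mean over a sphere
    of radius 0. *)
Lemma der_Nt x (t : R) : 0 <= t -> is_derive t 1 (Nt x) (Ntt x t).
Proof.
move=> t0; have D := derZ c (leibniz_rule t0 (der_G1 x) (@ct_G1 x) (@ct_G2 x)).
apply: (is_derive_eq D); rewrite /Ntt {1}/G1 subrr mul0r addr0 mean0_at0.
by rewrite /Phi /ext max_r.
Qed.

Lemma der_space_int (Psi Psi' : R -> E -> R) i (t : R) x :
  (forall r s x, is_derive x (evec i) (mean0 Psi r s) (mean0 Psi' r s x)) ->
  continuous (fun q : R * E => Psi q.1 q.2) -> continuous (fun q : R * E => Psi' q.1 q.2) ->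
  is_derive x (evec i)
    (fun x => c * \int[mu]_(s in `[0, t]%classic) ((t - s) * mean0 Psi (t - s) s x))
    (c * \int[mu]_(s in `[0, t]%classic) ((t - s) * mean0 Psi' (t - s) s x)).
Proof.
move=> D cPsi cPsi'; apply: derZ.
have ct (P : R -> E -> R) : continuous (fun q : R * E => P q.1 q.2) ->
    continuous (fun q : E * R => (t - q.2) * mean0 P (t - q.2) q.2 q.1).
  move=> cP; apply: ctM; first by ctn.
  apply: (ct_smean (r := fun q : E * R => t - q.2) (s := fun q => q.2) (x := fun q => q.1)
    (ct_one) cP); by ctn.
apply: (radon_derive_all (radon_itv 0 t) (f := fun x s => (t - s) * mean0 Psi (t - s) s x)
  (f' := fun x s => (t - s) * mean0 Psi' (t - s) s x)); try exact: ct.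
Qed.

Lemma der_Nx i (t : R) (x : E) : is_derive x (evec i) (NF F ^~ t) (Nx i x t).
Proof.
rewrite (_ : NF F ^~ t = (fun x => c * \int[mu]_(s in `[0, t]%classic) G0 x t s)).
  exact: (der_space_int _ _ (fun r s x => der_mean0_x H1 i r s x) (fam_ct H1) (fam_dct H1 i)).
by apply/funext => y; exact: NF_E.
Qed.

Lemma der_Nxx i (t : R) (x : E) : is_derive x (evec i) (Nx i ^~ t) (Nxx i x t).
Proof.
exact: (der_space_int _ _ (fun r s x => der_mean0_x (H2 i) i r s x)
  (fam_dct H1 i) (fam_dct (H2 i) i)).
Qed.

(** The point [x + (t - s) *: w] of the cone moves with velocity [- w], hence the minus sign at
    [mean1]. For [s > 0] freezing does not affect the time derivative. *)
Lemma der_backward_cone (x : E) (t s : R) : 0 < s ->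
  is_derive s 1 (fun s => mean0 Phi (t - s) s x)
    (mean0 Phit (t - s) s x - mean1 d (t - s) s x).
Proof.
move=> s0.
have cpt : continuous (fun q : R * E => x + (t - q.1) *: q.2) by ctn.
have ct_fst' : continuous (fun q : R * E => q.1) by move=> q; exact: cvg_fst.
have [_ [_ [dF _]]] := F2.
have r := radon_sph (R := R) k.
have cP := fam_ct H1.
have cd i := fam_dct H1 i.
have cPt := ct_source_t.
pose D s w := 1 * (Phit s (x + (t - s) *: w) + \sum_i (- w 0 i) * d i s (x + (t - s) *: w)).
have HD : is_derive s 1 (fun s => mean0 Phi (t - s) s x) (sph_int (D s)).
  apply: (radon_derive r (f := fun (s : R) (w : E) => 1 * Phi s (x + (t - s) *: w)) (f' := D)).
  (* Radius [s] keeps the time [s + h] positive. *)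
  - apply/nbhs_ballP; exists s => //= h; rewrite /ball/= sub0r normrN => /ltr_normlP[h1 h2] w.
    rewrite -[h *: 1]/(h * 1) mulr1; set u := s + h.
    have u0 : 0 < u by rewrite /u; lra.
    apply: derZ.
    apply: (chain_rule_time (H := Phi) (dH := d) (c := fun u => x + (t - u) *: w)
      (c' := fun i => - w 0 i)).
    + exact: fam_der H1.
    + exact: cd.
    + move=> i; rewrite (_ : (fun u => _) = (fun u => (x 0 i + t * w 0 i) + u * (- w 0 i))); last first.
        by apply/funext => v; rewrite !mxE; ring.
      apply: (is_derive_eq (derD (der_cst (x 0 i + t * w 0 i) u 1)
        (derM (der_id u) (der_cst (- w 0 i) _ _)))); ring.
    + rewrite /Phit /ext max_r; last exact: ltW.
      by apply: is_derive_tderiv => //; apply: dF; exact: ltW.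
  - by apply: ctM; [exact: ct_cst | exact: (ct_app2 cP ct_fst' cpt)].
  - apply: ctM; first exact: ct_cst.
    apply: ctD; first exact: (ct_app2 cPt ct_fst' cpt).
    apply: ct_sum => i; apply: ctM; last exact: (ct_app2 (cd i) ct_fst' cpt).
    by apply: ctN; apply: ct_coord => q; exact: cvg_snd.
apply: (is_derive_eq HD); rewrite -(mean1E H1) -(mean0E Phit).
have cd' i : continuous (fun w : E => d i s (x + (t - s) *: w)) by exact: ct_sphere_point (cd i).
have cw : continuous (fun w : E => \sum_i w 0 i * d i s (x + (t - s) *: w)).
  by apply: ct_sum => i; apply: ctM; [ctn | exact: cd'].
rewrite -(radonB r)//; last exact: ct_sphere_point.
rewrite /D; congr sph_int; apply/funext => w; rewrite mul1r; congr (_ + _).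
by rewrite -sumrN; apply: eq_bigr => i _; rewrite mulNr.
Qed.

(** Darboux's equation leaves the integral of [mean1] with coefficient 2 - k = - (n - 3). Replacing
    it by [E3] adds n - 3 copies of [omega k.+1 * F x t] to the one in [Ntt]; these n - 2 copies are
    what the factor [c] normalises to [F x t]. *)
Lemma N_wave (x : E) (t : R) : 0 <= t -> Ntt x t - \sum_i Nxx i x t =
  F x t - ((k.+1%:R - 3) / ((k.+1%:R - 2) * omega k.+1) *
    \int[mu]_(s in `[0, t]%classic) sphere_int (fun w : E => tderiv (F (x + (t - s) *: w)) s) +
  (k.+1%:R - 3) / ((k.+1%:R - 2) * omega k.+1) *
    sphere_int (fun w : E => F (x + t *: w) 0)).
Proof.
move=> t0.
have cl : continuous (fun s : R => t - s) by ctn.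
have ci : continuous (fun s : R => s) by ctn.
have r := radon_itv 0 t.
have c1 : continuous (fun s => mean1 d (t - s) s x) := ct_mean1 cl ci.
have c2 : continuous (fun s => mean2 dd (t - s) s x) := ct_mean2 cl ci.
have cP : continuous (fun s => mean0 Phi (t - s) s x) := ct_mean0 cl ci (fam_ct H1).
have cPt : continuous (fun s => mean0 Phit (t - s) s x) := ct_mean0 cl ci ct_source_t.
pose I (f : R -> R) := \int[mu]_(s in `[0, t]%classic) f s.
have E1 : int0 t (G2 x t) = 2 * I (fun s => mean1 d (t - s) s x) +
    I (fun s => (t - s) * mean2 dd (t - s) s x).
  rewrite -(int0E t0 (ct_slice (@ct_G2 x))) /I -(radonZ r)// -(radonD r)//; by ctn.
have E2 : \sum_i Nxx i x t = c * (I (fun s => (t - s) * mean2 dd (t - s) s x) +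
    k%:R * I (fun s => mean1 d (t - s) s x)).
  rewrite /Nxx -mulr_sumr; congr (_ * _).
  rewrite /I -(radonZ r)// -(radonD r); [|by ctn..].
  rewrite -(radon_sum r); last first.
    by move=> i; apply: ctM => //; exact: (@ct_mean0 x _ _ _ cl ci (dd i i) (fam_dct (H2 i) i)).
  congr Rintegral; apply/funext => s; rewrite -mulr_sumr.
  by rewrite (darboux_mean H1 H2).
have E3 : I (fun s => mean0 Phit (t - s) s x) - I (fun s => mean1 d (t - s) s x) =
    omega k.+1 * F x t - sphere_int (fun w : E => F (x + t *: w) 0).
  rewrite /I -(radonB r)//.
  have df (s : R) : 0 < s < t -> is_derive s 1 (fun s => mean0 Phi (t - s) s x)
      (mean0 Phit (t - s) s x - mean1 d (t - s) s x).
    by move=> /andP[s0 _]; exact: der_backward_cone.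
  rewrite (FTC t0 cP _ df); last by ctn.
  rewrite subrr mean0_at0 subr0 -mean0E /Phi /ext max_r// max_l//.
have -> : \int[mu]_(s in `[0, t]%classic) sphere_int (fun w : E => tderiv (F (x + (t - s) *: w)) s) =
    I (fun s => mean0 Phit (t - s) s x).
  apply: eq_Rintegral => s; rewrite inE /= in_itv/= => /andP[s0 _].
  by rewrite -mean0E /Phit /ext max_r.
rewrite /Ntt E1 E2.
have {E3}-> : sphere_int (fun w : E => F (x + t *: w) 0) = omega k.+1 * F x t -
    (I (fun s => mean0 Phit (t - s) s x) - I (fun s => mean1 d (t - s) s x)).
  by rewrite E3; ring.
have := dim_sub2_neq0 (R := R) k2.
rewrite /c (_ : k%:R = (k.+1%:R - 2) + 1 :> R); last by rewrite dim_sub2 subrK.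
rewrite (_ : k.+1%:R - 3 = (k.+1%:R - 2) - 1 :> R); last by ring.
set a := k.+1%:R - 2 => a0.
have w0 : omega k.+1 != 0 :> R := omega_neq0.
by field; rewrite w0 a0.
Qed.

Lemma N0_at0 x : N0 x 0 = 0.
Proof. by rewrite /N0 /int0 subrr mulr0. Qed.

Lemma Nt_at0 x : Nt x 0 = 0.
Proof. by rewrite /Nt /int0 subrr mulr0. Qed.

End Inhomogeneous.

(** * Superposition of the free part and Duhamel's integral *)

Unset Implicit Arguments.
Set Strict Implicit.
Set Printing Implicit Defensive.

Theorem theorem2p1 (R : realType) (n : nat) (eps : R)
  (f g : 'rV[R]_n -> R) (F u : 'rV[R]_n -> R -> R) :
  (3 <= n)%N -> 0 < eps ->
  Ck 3 f -> Ck 2 g -> HCk 2 F ->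
  (forall x t, 0 <= t -> u x t = eps * Vfun f g x t + NF F x t) ->
  (forall t, 0 <= t -> forall (i : 'I_n) (y : 'rV[R]_n),
      derivable (u ^~ t) y (evec i) /\ derivable (pderiv i (u ^~ t)) y (evec i)) /\
  exists ut utt : 'rV[R]_n -> R -> R,
    (forall x t, 0 <= t ->
       [/\ has_tderiv (u x) t (ut x t), has_tderiv (ut x) t (utt x t) &
           utt x t - lap (u ^~ t) x = F x t - Hfun eps f g F x t]) /\
    (forall x, u x 0 = eps * f x /\ ut x 0 = eps * g x).
Proof.
case: n f g F u => [//|k] f g F u k2 _ f3 g2 F2 uE.
(* Two forms of [u]: this one continues across t = 0 for the time derivatives, [utx] serves the
   space derivatives at fixed [t]. *)
have uV x t : 0 <= t -> u x t = eps * V0 f g x t + N0 F x t.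
  by move=> t0; rewrite uE// (VfunE f3 g2) (NF_N0 F2).
have utx t : 0 <= t -> u ^~ t = fun y => eps * V0 f g y t + NF F y t.
  by move=> t0; apply/funext => y; rewrite uE// (VfunE f3 g2).
have du t i y : 0 <= t -> is_derive y (evec i) (u ^~ t)
    (eps * Vx f g i y t + Nx F i y t).
  by move=> t0; rewrite utx//; exact: derD (derZ eps (der_Vx f3 g2 i t y)) (der_Nx F2 i t y).
have duE t i : 0 <= t -> pderiv i (u ^~ t) = fun y => eps * Vx f g i y t + Nx F i y t.
  by move=> t0; apply/funext => y; have [_ <-] := du t i y t0.
have ddu t i y : 0 <= t -> is_derive y (evec i) (pderiv i (u ^~ t))
    (eps * Vxx f g i y t + Nxx F i y t).
  by move=> t0; rewrite duE//; exact: derD (derZ eps (der_Vxx f3 g2 i t y)) (der_Nxx F2 i t y).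
split.
  by move=> t t0 i y; split; [have [] := du t i y t0 | have [] := ddu t i y t0].
exists (fun x t => eps * Vt f g x t + Nt F x t), (fun x t => eps * Vtt f g x t + Ntt F x t).
split; last first.
  move=> x; split; first by rewrite uV// V_at0 N0_at0 addr0.
  by rewrite Vt_at0 Nt_at0 addr0.
move=> x t t0; split.
- apply: (has_tderivW t0 (fun s s0 => uV x s s0)).
  exact: derD (derZ eps (der_V0 k2 f3 g2 x t)) (der_N0 F2 x t0).
- apply: (has_tderivW t0 (fun s _ => erefl)).
  exact: derD (derZ eps (der_Vt f3 g2 x t)) (der_Nt F2 x t0).
- have -> : lap (u ^~ t) x = eps * (\sum_i Vxx f g i x t) + \sum_i Nxx F i x t.
    rewrite mulr_sumr -big_split /=; apply: eq_bigr => i _.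
    by have [_ <-] := ddu t i x t0.
  have EV := V_wave k2 f3 g2 x t; have EN := N_wave k2 F2 x t0.
  rewrite (_ : _ - _ = eps * (Vtt f g x t - \sum_i Vxx f g i x t) +
    (Ntt F x t - \sum_i Nxx F i x t)); last by ring.
  by rewrite EV EN /Hfun; ring.
Qed.
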